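(* Let $(b_n)$ be a monotone sequence with $b_n>0$, $\lim_n b_n=\infty$, $\lim_n b_n/b_{n-1}=1$ and $\sum_n 1/b_n=\infty$. Then there exists a weight $w(x)>0$ on the real line $\mathbb R$ such that the orthonormal polynomials $p_n$, $n=0,1,\dots$, with respect to $w(x)\,dx$ form an (orthonormal) basis in $L^2(\mathbb R,w\,dx)$ and $$|p_n(x)|^2\le \frac{C(x)}{b_n}\quad\text{for all }n\text{ and }x\in\mathbb R,$$ where $C(x)>0$ is a locally bounded function on $\mathbb R$.
   Context: The orthonormal polynomials with respect to a measure $\nu$ on $\mathbb R$ are the polynomials $p_n$ of degree $n$ with positive leading coefficient obtained by Gram–Schmidt orthonormalization of $1,x,x^2,\dots$ in $L^2(\nu)$. *)

(* Defs.v *)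
From HB Require Import structures.
From mathcomp Require Import all_boot all_order all_algebra.
From mathcomp Require Import all_classical all_reals all_analysis.
Set Implicit Arguments. Unset Strict Implicit. Unset Printing Implicit Defensive.
Import Order.TTheory GRing.Theory Num.Theory.
Import numFieldNormedType.Exports.
Local Open Scope classical_set_scope.
Local Open Scope ring_scope.

Section Defs.
Variable R : realType.
Local Notation leb := (@lebesgue_measure R).

(* A weight on R: measurable, strictly positive, with all moments finite
   (so that all polynomials lie in L^2(w dx)). *)
Definition is_weight (w : R -> R) : Prop :=
  measurable_fun setT w /\ (forall x, 0 < w x) /\
  forall n : nat, leb.-integrable setT (fun x => (x ^+ n * w x)%:E).

Definition wip (w : R -> R) (f g : R -> R) : \bar R :=
  (\int[leb]_x (f x * g x * w x)%:E)%E.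

Definition in_L2 (w : R -> R) (f : R -> R) : Prop :=
  measurable_fun setT f /\ leb.-integrable setT (fun x => (f x ^+ 2 * w x)%:E).

(* p is the sequence of orthonormal polynomials w.r.t. w dx: deg p_n = n,
   positive leading coefficient, <p_n, p_m>_w = delta_{nm}
   (this is exactly the output of Gram-Schmidt applied to 1, x, x^2, ...). *)
Definition orthonormal_polys (w : R -> R) (p : nat -> {poly R}) : Prop :=
  (forall n, size (p n) = n.+1) /\
  (forall n, 0 < lead_coef (p n)) /\
  (forall n m, wip w (fun x => (p n).[x]) (fun x => (p m).[x])
               = ((n == m)%:R)%:E).

Definition is_L2_basis (w : R -> R) (p : nat -> {poly R}) : Prop :=
  forall f, in_L2 w f -> forall eps : R, 0 < eps ->
    exists (N : nat) (c : nat -> R),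
      (\int[leb]_x ((f x - \sum_(i < N) c i * (p i).[x]) ^+ 2 * w x)%:E
        < eps%:E)%E.

Definition locally_bounded (C : R -> R) : Prop :=
  forall x : R, exists2 d : R, 0 < d &
    exists M : R, forall y : R, `|y - x| < d -> `|C y| <= M.

Definition monotone_seq (b : nat -> R) : Prop :=
  (forall n, b n <= b n.+1) \/ (forall n, b n.+1 <= b n).

End Defs.

(* Main.v *)
Require Import Defs.
From HB Require Import structures.
From mathcomp Require Import all_boot all_order all_algebra.
From mathcomp Require Import all_classical all_reals all_analysis.
From mathcomp.real_closed Require Import complex.
From mathcomp Require Import measurable_realfun ring lra.
Set Implicit Arguments. Unset Strict Implicit. Unset Printing Implicit Defensive.
Import Order.TTheory GRing.Theory Num.Theory.
Import numFieldNormedType.Exports.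
Local Open Scope classical_set_scope.
Local Open Scope ring_scope.

(** The weight is built from a Jacobi matrix.  Take zero diagonal and
    off-diagonal entries [a (2k) = b (2k)], [a (2k+1) = sqrt (b (2k) b (2k+2))],
    which are comparable with [b], and let [q n] be the polynomials of the
    recurrence [x q_n = a_n q_(n+1) + a_(n-1) q_(n-1)].

    - Because consecutive ratios of [a] agree in pairs, the quadratic form
      [E_k(x) = b_(2k) (q_(2k)^2 + q_(2k+1)^2) - x q_(2k) q_(2k+1)] satisfies
      [|E_(k+1) - E_k| <= 3 M E_k (1 / b_(2k) - 1 / b_(2k+2))] for [|x| <= M].
      The right-hand side telescopes, so [E_k] converges, uniformly bounded
      above and below on compact sets, to some [S > 0]; the weight is
      [w = 1 / (pi S)] and [b_n q_n^2] is locally bounded.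
    - The weights [1 / (pi a_n (q_n^2 + q_(n+1)^2))] make [q_0, ..., q_n]
      orthonormal: up to real and imaginary parts one integrates [g / P] with
      [P = q_(n+1) - i q_n], whose roots lie in the upper half-plane by
      Christoffel-Darboux, and partial fractions reduce this to
      [1 / (x - z)].  These weights converge to [w] while their moments
      stabilize, so the [q_n] are orthonormal for [w].
    - If [K_N(z) = \sum_(i < N) |q_i(z)|^2], then the polynomial
      [h(x) = \sum_(i < N) q_i(x) conj(q_i(z)) / K_N(z)] has [h(z) = 1] and
      squared norm [1 / K_N(z)], and [(1 - h(x)) / (x - z)] is a polynomial at
      distance at most [1 / (|Im z| sqrt (K_N(z)))] from [1 / (x - z)].
      Christoffel-Darboux and [\sum 1 / a_n = oo] give [K_N(z) -> oo], so the
      Poisson kernels are limits of polynomials in L^2(w); so are their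
      integrals over intervals (arctangents), indicators of intervals, and
      finally every L^2 function. *)

(** * Principal values of rational functions *)

Section PV.
Variable R : realType.
Implicit Types (x y a b : R) (z w : R[i]).
Local Notation Re := (@complex.Re R).
Local Notation Im := (@complex.Im R).

(* Stating principal values through antiderivatives makes them linear without
   any integrability hypothesis. *)
Definition pvi (phi : R -> R) (v : R) :=
  exists2 F : R -> R, (forall x, is_derive x 1 F (phi x)) &
    F n%:R - F (- n%:R) @[n --> \oo] --> v.

Definition cpvi (Phi : R -> R[i]) (v : R[i]) :=
  pvi (fun x => Re (Phi x)) (Re v) /\ pvi (fun x => Im (Phi x)) (Im v).

Lemma pviD f g u v : pvi f u -> pvi g v -> pvi (fun x => f x + g x) (u + v).
Proof.
move=> [F dF Fu] [G dG Gv]; exists (fun x => F x + G x).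
  by move=> x; apply: is_deriveD.
rewrite (_ : (fun n : nat => _) =
  (fun n : nat => (F n%:R - F (- n%:R)) + (G n%:R - G (- n%:R)))).
  exact: cvgD.
by apply/funext => n; ring.
Qed.

Lemma pviZ c f v : pvi f v -> pvi (fun x => c * f x) (c * v).
Proof.
move=> [F dF Fv]; exists (fun x => c * F x).
  by move=> x; apply: is_deriveZ.
rewrite (_ : (fun n : nat => _) = (fun n : nat => c * (F n%:R - F (- n%:R)))).
  exact: cvgMr.
by apply/funext => n; ring.
Qed.

Lemma complex_ReD z w : Re (z + w) = Re z + Re w. Proof. by case: z w => ? ? []. Qed.
Lemma complex_ImD z w : Im (z + w) = Im z + Im w. Proof. by case: z w => ? ? []. Qed.
Lemma complex_ReM z w : Re (z * w) = Re z * Re w + - Im w * Im z.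
Proof. by case: z w => ? ? [] ? ? /=; ring. Qed.
Lemma complex_ImM z w : Im (z * w) = Re z * Im w + Re w * Im z.
Proof. by case: z w => ? ? [] ? ? /=; ring. Qed.

Lemma cpviD f g u v : cpvi f u -> cpvi g v -> cpvi (fun x => f x + g x) (u + v).
Proof.
move=> [f1 f2] [g1 g2]; split.
  by rewrite complex_ReD; under eq_fun do rewrite complex_ReD; exact: pviD.
by rewrite complex_ImD; under eq_fun do rewrite complex_ImD; exact: pviD.
Qed.

Lemma cpviZ c f v : cpvi f v -> cpvi (fun x => c * f x) (c * v).
Proof.
move=> [f1 f2]; split.
  rewrite complex_ReM mulNr -mulrN [_ * - _]mulrC mulNr -mulNr.
  under eq_fun do rewrite complex_ReM mulNr -mulrN [_ * - _]mulrC mulNr -mulNr.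
  by apply: pviD; apply: pviZ.
rewrite complex_ImM [X in _ + X]mulrC.
under eq_fun do rewrite complex_ImM [X in _ + X]mulrC.
by apply: pviD; apply: pviZ.
Qed.

Lemma cpviB f g u v : cpvi f u -> cpvi g v -> cpvi (fun x => f x - g x) (u - v).
Proof.
move=> fu /(cpviZ (-1)) gv.
rewrite -mulN1r; under eq_fun do rewrite -mulN1r.
exact: cpviD.
Qed.

Lemma resolventE a b x : (x%:C%C - (a +i* b)%C)^-1 =
  ((x - a) / ((x - a) ^+ 2 + b ^+ 2) +i* (b / ((x - a) ^+ 2 + b ^+ 2)))%C.
Proof.
by rewrite /GRing.inv /= sub0r sqrrN !mulNr opprK.
Qed.

Lemma resolvent_den a b x : 0 < b -> 0 < (x - a) ^+ 2 + b ^+ 2.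
Proof. by move=> b0; rewrite ltr_wpDl ?sqr_ge0 ?exprn_gt0. Qed.


Definition cderiv (f df : R -> R[i]) := forall x,
  is_derive x 1 (fun x => Re (f x)) (Re (df x)) /\
  is_derive x 1 (fun x => Im (f x)) (Im (df x)).

Lemma cderivM f df g dg : cderiv f df -> cderiv g dg ->
  cderiv (fun x => f x * g x) (fun x => df x * g x + f x * dg x).
Proof.
move=> Df Dg x; have [f1 f2] := Df x; have [g1 g2] := Dg x.
under eq_fun do rewrite complex_ReM.
under [X in _ /\ is_derive _ _ X _]eq_fun do rewrite complex_ImM.
rewrite complex_ReD complex_ImD !complex_ReM !complex_ImM; split; apply: is_derive_eq;
  rewrite /GRing.scale /=; ring.
Qed.

Lemma cderiv_resolvent a b : 0 < b ->
  cderiv (fun x => (x%:C%C - (a +i* b)%C)^-1)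
         (fun x => - (x%:C%C - (a +i* b)%C)^-1 ^+ 2).
Proof.
move=> b0 x; have /lt0r_neq0 d0 := resolvent_den a x b0.
under eq_fun do rewrite resolventE.
under [X in _ /\ is_derive _ _ X _]eq_fun do rewrite resolventE.
rewrite resolventE /=; split; apply: is_derive_eq;
  rewrite /GRing.scale /=; field; exact: d0.
Qed.

(** Supplies rational antiderivatives for the powers of exponent at least two; only the first power
    needs a logarithm and an arctangent. *)
Lemma cderiv_resolventX a b n : 0 < b ->
  cderiv (fun x => (x%:C%C - (a +i* b)%C)^-1 ^+ n)
         (fun x => - n%:R * (x%:C%C - (a +i* b)%C)^-1 ^+ n.+1).
Proof.
move=> b0; elim: n => [|n IH].
  move=> x; rewrite oppr0 mul0r; split;
    exact: is_derive_cst.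
have := cderivM (cderiv_resolvent a b0) IH; congr cderiv; apply/funext => x.
  by rewrite exprS.
rewrite -[in RHS]natr1 !exprS; ring.
Qed.

(** The sequence [u] covers both endpoints [n] and [- n] of the truncated line. Both parts are at
    most [1 / (n - |a|)] once [n > |a|]. *)
Lemma cvg_resolvent a b (u : nat -> R) : 0 < b -> (forall n, `|u n| = n%:R) ->
  Re ((u n)%:C%C - (a +i* b)%C)^-1 @[n --> \oo] --> 0 /\
  Im ((u n)%:C%C - (a +i* b)%C)^-1 @[n --> \oo] --> 0.
Proof.
move=> b0 un.
have H : (n%:R - `|a|)^-1 @[n --> \oo] --> (0 : R).
  apply/gtr0_cvgV0.
    near=> n; rewrite subr_gt0.
    near: n; exact: nbhs_infty_gtr.
  apply/cvgryPge => A; near=> n; rewrite lerBrDr; near: n.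
  exact: nbhs_infty_ger.
have B x : `|a| < `|x| ->
    `|Re (x%:C%C - (a +i* b)%C)^-1| <= (`|x| - `|a|)^-1 /\
    `|Im (x%:C%C - (a +i* b)%C)^-1| <= (`|x| - `|a|)^-1.
  move=> ax; rewrite resolventE /=.
  have d0 := resolvent_den a x b0.
  have xa : `|x| - `|a| <= `|x - a| by exact: lerB_dist.
  have p0 : 0 < `|x| - `|a| by rewrite subr_gt0.
  have q0 : 0 < `|x - a| by exact: lt_le_trans xa.
  have E : (x - a) ^+ 2 = `|x - a| ^+ 2 by rewrite real_normK // num_real.
  rewrite !normrM normfV (gtr0_norm d0) (gtr0_norm b0).
  rewrite !ler_pdivrMr // ![(_ - _)^-1 * _]mulrC !ler_pdivlMr // E.
  move: xa p0 q0; set p := _ - _; set q := `|_| => xa p0 q0.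
  have h1 : 0 <= q * (q - p) by rewrite mulr_ge0 ?subr_ge0 // ltW.
  have h2 : 0 <= b * (q - p) by rewrite mulr_ge0 ?subr_ge0 // ltW.
  have h3 := sqr_ge0 (q - b); have h4 := sqr_ge0 b; have h5 := sqr_ge0 q.
  split; nra.
have C (f : R -> R) : (forall x, `|a| < `|x| -> `|f x| <= (`|x| - `|a|)^-1) ->
    f (u n) @[n --> \oo] --> 0.
  move=> fB; apply: norm_cvg0.
  have G : \forall n \near \oo, 0 <= `|f (u n)| <= (n%:R - `|a|)^-1.
    near=> n; rewrite normr_ge0 /=.
    have := fB (u n); rewrite un; apply.
    near: n; exact: nbhs_infty_gtr.
  exact: (squeeze_cvgr G (cvg_cst _) H).
split; [apply: (C (fun x => Re (x%:C%C - (a +i* b)%C)^-1))|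
        apply: (C (fun x => Im (x%:C%C - (a +i* b)%C)^-1))] => x /B[] //.
Unshelve. all: by end_near.
Qed.

Lemma cvg_resolventX a b (u : nat -> R) n : 0 < b -> (forall n, `|u n| = n%:R) ->
  Re (((u m)%:C%C - (a +i* b)%C)^-1 ^+ n.+1) @[m --> \oo] --> 0 /\
  Im (((u m)%:C%C - (a +i* b)%C)^-1 ^+ n.+1) @[m --> \oo] --> 0.
Proof.
move=> b0 un; have [r1 r2] := cvg_resolvent a b0 un.
elim: n => [|n [IH1 IH2]]; first by under eq_fun do rewrite expr1;
  under [X in _ /\ (X @ _ --> _)]eq_fun do rewrite expr1.
under eq_fun do rewrite exprS complex_ReM mulNr.
under [X in _ /\ (X @ _ --> _)]eq_fun do rewrite exprS complex_ImM.
split.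
  rewrite -[0](_ : 0 * 0 - 0 * 0 = 0 :> R); last by ring.
  by apply: cvgB; apply: cvgM.
rewrite -[0](_ : 0 * 0 + 0 * 0 = 0 :> R); last by ring.
by apply: cvgD; apply: cvgM.
Qed.

(** The antiderivative is a power of the resolvent and vanishes at both ends, so a pole of order at
    least two contributes nothing. *)
Lemma cpvi_resolventX a b n : 0 < b ->
  cpvi (fun x => (x%:C%C - (a +i* b)%C)^-1 ^+ n.+2) 0.
Proof.
move=> b0.
suff : cpvi (fun x => - n.+1%:R * (x%:C%C - (a +i* b)%C)^-1 ^+ n.+2) 0.
  move=> /(cpviZ (- n.+1%:R^-1)); rewrite mulr0; congr cpvi.
  by apply/funext => x; rewrite mulrA mulrNN mulVf ?mul1r // pnatr_eq0.
have D := @cderiv_resolventX a b n.+1 b0.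
have [p1 p2] := cvg_resolventX a n b0 (fun m => normr_nat R m).
have Nn m : `|- m%:R : R| = m%:R by rewrite normrN normr_nat.
have [m1 m2] := cvg_resolventX a n b0 Nn.
split.
  exists (fun x => Re ((x%:C%C - (a +i* b)%C)^-1 ^+ n.+1)) => [x|]; first by have [] := D x.
  rewrite -[Re 0](subr0 0); exact: cvgB p1 m1.
exists (fun x => Im ((x%:C%C - (a +i* b)%C)^-1 ^+ n.+1)) => [x|]; first by have [] := D x.
rewrite -[Im 0](subr0 0); exact: cvgB p2 m2.
Qed.

Lemma cvg_ln_quot a b : 0 < b ->
  2^-1 * ln ((n%:R - a) ^+ 2 + b ^+ 2) - 2^-1 * ln ((- n%:R - a) ^+ 2 + b ^+ 2)
    @[n --> \oo] --> 0.
Proof.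
move=> b0; have [r1 r2] := cvg_resolvent (- a) b0 (fun m => normr_nat R m).
(* [g n] is the quotient of the two arguments of [ln]; written through the resolvent at [- a + i b],
   it tends to [1] by [cvg_resolvent]. *)
pose g (n : nat) := 1 - 4 * a * (Re (n%:R%:C%C - (- a +i* b)%C)^-1 - a / b *
    Im (n%:R%:C%C - (- a +i* b)%C)^-1).
have L : g n @[n --> \oo] --> (1 : R).
  rewrite -[X in _ --> X](_ : 1 - 4 * a * (0 - a / b * 0) = 1 :> R); last by ring.
  apply: cvgB; first exact: cvg_cst.
  apply: cvgM; first exact: cvg_cst.
  apply: cvgB => //; apply: cvgM => //; exact: cvg_cst.
have L1 : 2^-1 * ln (g n) @[n --> \oo] --> 0.
  have E : (0 : R) = 2^-1 * ln 1 by rewrite ln1 mulr0.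
  rewrite [X in _ --> X]E.
  apply: cvgM; first exact: cvg_cst.
  exact: (cvg_comp _ _ L (continuous_ln ltr01)).
rewrite (_ : (fun n : nat => _) = (fun n => 2^-1 * ln (g n))) //.
apply/funext => n; rewrite /g resolventE -mulrBr; congr (_ * _).
have d1 := resolvent_den a n%:R b0.
have d2 := resolvent_den a (- n%:R) b0.
have d3 := resolvent_den (- a) n%:R b0.
rewrite -ln_div ?posrE //; congr ln; rewrite /=.
have db := lt0r_neq0 b0; move/lt0r_neq0: d2; move/lt0r_neq0: d3.
rewrite -(sqrrN (- n%:R - a)) opprB opprK addrC => d3 d2.
field; rewrite db andbT; exact: d3.
Qed.

Lemma cvg_natD_div (s b : R) : 0 < b -> (n%:R + s) / b @[n --> \oo] --> +oo.
Proof.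
move=> b0; apply/cvgryPge => A; near=> n.
rewrite ler_pdivlMr // -lerBlDr; near: n; exact: nbhs_infty_ger.
Unshelve. all: by end_near. Qed.

(** The real part has a logarithm as antiderivative, whose two ends cancel because the truncation is
    symmetric; the arctangent of the imaginary part runs from [- pi / 2] to [pi / 2]. *)
Lemma cpvi_resolvent a b : 0 < b ->
  cpvi (fun x => (x%:C%C - (a +i* b)%C)^-1) (0 +i* pi)%C.
Proof.
move=> b0; have d0 x := resolvent_den a x b0.
have db := lt0r_neq0 b0.
split.
  exists (fun x => 2^-1 * ln ((x - a) ^+ 2 + b ^+ 2)).
    move=> x; rewrite resolventE /=.
    have /lt0r_neq0 dn := d0 x.
    have H := is_derive1_ln (d0 x).
    apply: is_derive_eq; rewrite /GRing.scale /=; field; exact: dn.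
  exact: cvg_ln_quot.
exists (fun x => atan ((x - a) / b)).
  move=> x; rewrite resolventE /=.
  have /lt0r_neq0 dn := d0 x.
  apply: is_derive_eq; rewrite /GRing.scale /=; field.
  by rewrite db dn.
have -> : Im (0 +i* pi)%C = pi / 2 - - (pi / 2) :> R by rewrite /= opprK -splitr.
apply: cvgB.
  exact: (cvg_comp _ _ (cvg_natD_div (- a) b0) (@cvgy_atan R)).
under eq_fun do rewrite -opprD mulNr atanN.
apply: cvgN.
exact: (cvg_comp _ _ (cvg_natD_div a b0) (@cvgy_atan R)).
Qed.
End PV.

(** * Partial fractions with all poles in the upper half-plane *)

Section PVrat.
Variable R : realType.
Implicit Types (x y a b : R) (z w : R[i]) (s : seq R[i]).
Local Notation Re := (@complex.Re R).
Local Notation Im := (@complex.Im R).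
Local Notation C := R[i].
Local Notation cst_pi := (0 +i* pi)%C.

Definition inv_prod s x : C := \prod_(z <- s) (x%:C%C - z)^-1.

Lemma upper_neq0 z x : 0 < Im z -> x%:C%C - z != 0.
Proof.
case: z => a b /= b0; rewrite subr_eq0; apply/negP => /eqP [_ b00].
by rewrite -b00 ltxx in b0.
Qed.

Lemma perm_inv_prod s t : perm_eq s t -> inv_prod s = inv_prod t.
Proof. by move=> st; apply/funext => x; exact: perm_big. Qed.

(** If all poles coincide, the product is a power of one resolvent. Otherwise two distinct poles
    [z], [w] are separated by [1 / ((x - z) (x - w)) = (1 / (x - z) - 1 / (x - w)) / (z - w)]; both
    products have one factor less and the same value, so their difference contributes [0]. *)
Lemma cpvi_inv_prod s : all (fun z => 0 < Im z) s -> s != [::] ->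
  cpvi (inv_prod s) (if size s == 1%N then cst_pi else 0).
Proof.
move: {2}(size s) (leqnn (size s)) => n; elim: n s => [|n IH] [|z s] //= sn.
move=> /andP[z0 s0] _.
have [sz|] := boolP (all (pred1 z) s).
  have -> : inv_prod (z :: s) = (fun x => (x%:C%C - z)^-1 ^+ (size s).+1).
    apply/funext => x; rewrite /inv_prod big_cons exprS; congr (_ * _).
    elim: s sz {sn s0} => [|w s IHs] /=; first by rewrite big_nil expr0.
    by move=> /andP[/eqP -> sz]; rewrite big_cons exprS IHs.
  case: z z0 {sz} => a b /= b0; case: s {sn s0} => [|w s] /=.
    under eq_fun do rewrite expr1; exact: cpvi_resolvent.
  exact: cpvi_resolventX.
case/allPn => w ws /= wz; have w0 := allP s0 _ ws.
have pw := perm_to_rem ws.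
have szs : size s = (size (rem w s)).+1 by rewrite (perm_size pw).
have rem0 : all (fun z => 0 < Im z) (rem w s).
  by apply/allP => u /mem_rem; exact: (allP s0).
have -> : inv_prod (z :: s) = (fun x => (z - w)^-1 *
    (inv_prod (z :: rem w s) x - inv_prod (w :: rem w s) x)).
  have /perm_inv_prod -> : perm_eq (z :: s) (z :: w :: rem w s).
    by rewrite perm_cons.
  apply/funext => x; rewrite /inv_prod !big_cons.
  have := upper_neq0 x z0; have := upper_neq0 x w0.
  have : z - w != 0 by rewrite subr_eq0 eq_sym.
  move=> h1 h2 h3; field.
  by rewrite h1 h2 h3.
rewrite szs /= -[X in cpvi _ X](mulr0 (z - w)^-1).
apply: cpviZ; rewrite -(subrr (if (size (rem w s)).+1 == 1%N then cst_pi else 0)).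
apply: cpviB; apply: IH; rewrite //= ?z0 ?w0 ?rem0 //.
  by rewrite -szs -ltnS.
by rewrite -szs -ltnS.
Qed.

(** Euclidean division [g = h (X - z) + g(z)] removes the factor of [z] from the first summand and
    preserves the top coefficient. The remainder contributes [0] as long as at least two factors are
    present. *)
Lemma cpvi_poly_inv_prod s (g : {poly C}) : all (fun z => 0 < Im z) s ->
  s != [::] -> (size g <= size s)%N ->
  cpvi (fun x => g.[x%:C%C] * inv_prod s x) (g`_(size s).-1 * cst_pi).
Proof.
elim: s g => [|z [|w s] IH] g //= /andP[z0 s0] _ gs.
  rewrite (size1_polyC gs) coefC /=.
  under eq_fun do rewrite hornerC.
  by apply: cpviZ; apply: (@cpvi_inv_prod [:: z]) => //=; rewrite z0.
have /factor_theorem[h Eg] : root (g - g.[z]%:P) z.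
  by rewrite /root !hornerE subrr.
have {}Eg : g = h * ('X - z%:P) + g.[z]%:P by rewrite -Eg subrK.
have sh : (size h <= size (w :: s))%N.
  have [->|h0] := eqVneq h 0; first by rewrite size_poly0.
  have := size_Mmonic h0 (monicXsubC z); rewrite size_XsubC addn2 /= => sE.
  rewrite -ltnS -sE.
  have -> : h * ('X - z%:P) = g - g.[z]%:P.
    by apply/esym/eqP; rewrite subr_eq; apply/eqP.
  apply: (leq_trans (size_polyD _ _)); rewrite geq_max gs size_polyN.
  by apply: leq_trans (size_polyC_leq1 _) _.
have -> : (fun x => g.[x%:C%C] * inv_prod [:: z, w & s] x) =
    (fun x => h.[x%:C%C] * inv_prod (w :: s) x +
              g.[z] * inv_prod [:: z, w & s] x).
  apply/funext => x; rewrite {1}Eg !hornerE [inv_prod (z :: _) _]big_cons.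
  have := upper_neq0 x z0; rewrite -/(inv_prod (w :: s) x) => xz.
  field. exact: xz.
have -> : g`_(size s).+1 = h`_(size s) by
  rewrite {1}Eg coefD coefC /= addr0 mulrBr coefB coefMX coefMC /=
    [h`_(size s).+1]nth_default ?mul0r ?subr0.
rewrite -[X in cpvi _ X]addr0 -{2}(mulr0 g.[z]).
apply: cpviD; first by apply: IH.
by apply: cpviZ; apply: (@cpvi_inv_prod [:: z, w & s]) => //=; rewrite z0.
Qed.

Lemma cpvi_ratio (P g : {poly C}) (n : nat) : size P = n.+2 ->
  (forall z, root P z -> 0 < Im z) -> (size g <= n.+1)%N ->
  cpvi (fun x => g.[x%:C%C] / P.[x%:C%C]) (g`_n / lead_coef P * cst_pi).
Proof.
move=> sP rP sg; have [s EP] := closed_field_poly_normal P.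
have P0 : lead_coef P != 0 by rewrite lead_coef_eq0 -size_poly_eq0 sP.
have ss : size s = n.+1.
  by move: sP; rewrite EP size_scale // size_prod_XsubC => -[].
have s0 : all (fun z => 0 < Im z) s.
  by apply/allP => z zs; apply: rP; rewrite EP rootZ // root_prod_XsubC.
have -> : (fun x => g.[x%:C%C] / P.[x%:C%C]) =
    (fun x => (lead_coef P)^-1 * (g.[x%:C%C] * inv_prod s x)).
  apply/funext => x; rewrite {1}EP hornerZ horner_prod invfM mulrCA mulrA.
  rewrite -mulrA; congr (_ * (_ * _)).
  by rewrite /inv_prod -prodfV; apply: eq_bigr => z _; rewrite !hornerE.
rewrite (mulrC g`_n) -mulrA; apply: cpviZ.
have := @cpvi_poly_inv_prod s g s0; rewrite ss /=; apply => //.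
by rewrite -size_eq0 ss.
Qed.

Lemma real_div_complex c a b : c%:C%C / (a -i* b)%C =
  (c * a / (a ^+ 2 + b ^+ 2) +i* (c * b / (a ^+ 2 + b ^+ 2)))%C.
Proof.
rewrite {1}/GRing.inv /= sqrrN; simpc.
by congr (_ +i* _)%C; ring.
Qed.

(** On the real line [1 / (A - i B) = (A + i B) / (A^2 + B^2)], so the two claims are the real and
    imaginary parts of [cpvi_ratio]; as [B] has smaller degree, [A - i B] has the leading
    coefficient of [A]. *)
Lemma pvi_ratio (A B g : {poly R}) n : size A = n.+2 -> (size B <= n.+1)%N ->
  (forall z, root (map_poly (real_complex R) A -
                   'i%C *: map_poly (real_complex R) B) z -> 0 < Im z) ->
  (size g <= n.+1)%N ->
  pvi (fun x => g.[x] * A.[x] / (A.[x] ^+ 2 + B.[x] ^+ 2)) 0 /\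
  pvi (fun x => g.[x] * B.[x] / (A.[x] ^+ 2 + B.[x] ^+ 2))
    (pi * (g`_n / lead_coef A)).
Proof.
move=> sA sB rP sg; set P := (X in root X) in rP.
have sP : size P = n.+2.
  rewrite size_polyDl ?size_map_poly // size_polyN.
  by rewrite (leq_ltn_trans (size_scale_leq _ _)) // size_map_poly sA ltnS.
have lP : lead_coef P = (lead_coef A)%:C%C.
  rewrite lead_coefDl ?lead_coef_map // size_polyN.
  by rewrite (leq_ltn_trans (size_scale_leq _ _)) // !size_map_poly sA ltnS.
have := @cpvi_ratio P (map_poly (real_complex R) g) n sP rP.
rewrite size_map_poly lP coef_map => /(_ sg) [].
have E x : (map_poly (real_complex R) g).[x%:C%C] / P.[x%:C%C] =
   ((g.[x] * A.[x] / (A.[x] ^+ 2 + B.[x] ^+ 2)) +i*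
    (g.[x] * B.[x] / (A.[x] ^+ 2 + B.[x] ^+ 2)))%C.
  rewrite -real_div_complex /P hornerD hornerN hornerZ !horner_map /=.
  by congr (_ / _); simpc.
under eq_fun do rewrite E /=; move=> H1.
under eq_fun do rewrite E /=; move=> H2.
have V : (real_complex R) g`_n / (lead_coef A)%:C%C * (0 +i* pi)%C =
    (0 +i* (pi * (g`_n / lead_coef A)))%C.
  by rewrite -fmorph_div /=; simpc; rewrite mulrC.
by split; [move: H1|move: H2]; rewrite V.
Qed.
End PVrat.

(** * Jacobi polynomials *)

Section Jacobi.
Variables (R : realType) (a : nat -> R).
Hypothesis a_gt0 : forall n, 0 < a n.
Implicit Types (x y : R) (z w : R[i]) (g : {poly R}).
Local Notation Re := (@complex.Re R).
Local Notation Im := (@complex.Im R).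

(** Two consecutive polynomials are carried along, which makes the three-term recurrence a
    structural recursion. *)
Fixpoint jacobi_pair n : {poly R} * {poly R} :=
  if n is m.+1 then
    let: (u, v) := jacobi_pair m in (v, (a m.+1)^-1 *: ('X * v - a m *: u))
  else (1, (a 0)^-1 *: 'X).

Definition jacobi n := (jacobi_pair n).1.
Local Notation q := jacobi.

Lemma jacobi0 : q 0 = 1. Proof. by []. Qed.

Lemma jacobi1 : q 1 = (a 0)^-1 *: 'X. Proof. by []. Qed.

Lemma jacobiSS n : q n.+2 = (a n.+1)^-1 *: ('X * q n.+1 - a n *: q n).
Proof. by rewrite /jacobi /=; case: (jacobi_pair n). Qed.

Let an0 n : a n != 0. Proof. exact: lt0r_neq0. Qed.

Lemma jacobi_rec n : a n *: q n = 'X * q n.+1 - a n.+1 *: q n.+2.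
Proof. by rewrite jacobiSS scalerA divff // scale1r opprB addrC subrK. Qed.

Lemma size_lead_jacobi n : size (q n) = n.+1 /\ 0 < lead_coef (q n) /\
  a n * lead_coef (q n.+1) = lead_coef (q n).
Proof.
have ai m : (a m)^-1 != 0 by rewrite invr_eq0.
suff H m : [/\ size (q m) = m.+1, size (q m.+1) = m.+2, 0 < lead_coef (q m) &
    a m * lead_coef (q m.+1) = lead_coef (q m)] by have [? ? ? ?] := H n.
elim: m => [|m [s0 s1 l0 l1]].
  rewrite jacobi0 jacobi1 size_poly1 size_scale // size_polyX lead_coef1 ltr01.
  by rewrite lead_coefZ lead_coefX mulr1 divff.
have nz : q m.+1 != 0 by rewrite -size_poly_eq0 s1.
have sX : size ('X * q m.+1) = m.+3 by rewrite mulrC size_mulX // s1.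
have lt : (size (- (a m *: q m)) < size ('X * q m.+1)%R)%N.
  by rewrite size_polyN size_scale // s0 sX.
have l2 : a m.+1 * lead_coef (q m.+2) = lead_coef (q m.+1).
  rewrite jacobiSS lead_coefZ lead_coefDl // mulrA divff // mul1r.
  by rewrite lead_coefM lead_coefX mul1r.
split => //; first by rewrite jacobiSS size_scale // size_polyDl.
by rewrite -(pmulr_rgt0 _ (a_gt0 m)) l1.
Qed.

Lemma size_jacobi n : size (q n) = n.+1.
Proof. by have [] := size_lead_jacobi n. Qed.

Lemma lead_jacobi_gt0 n : 0 < lead_coef (q n).
Proof. by have [_ []] := size_lead_jacobi n. Qed.

Lemma lead_jacobiS n : a n * lead_coef (q n.+1) = lead_coef (q n).
Proof. by have [_ []] := size_lead_jacobi n. Qed.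

Lemma jacobi_horner_rec n x :
  a n * (q n).[x] = x * (q n.+1).[x] - a n.+1 * (q n.+2).[x].
Proof. by have /(congr1 (horner^~ x)) := jacobi_rec n; rewrite !hornerE. Qed.

Definition jacobiC n z := (map_poly (real_complex R) (q n)).[z].

Lemma jacobiC0 z : jacobiC 0 z = 1.
Proof. by rewrite /jacobiC jacobi0 rmorph1 hornerE. Qed.

Lemma jacobiC1 z : (a 0)%:C%C * jacobiC 1 z = z.
Proof.
rewrite /jacobiC jacobi1 map_polyZ /= map_polyX hornerZ hornerX /=.
by rewrite -[X in _ * (X * _)]/(real_complex R _) fmorphV mulVKf // fmorph_eq0.
Qed.

Lemma jacobiC_rec n z :
  (a n)%:C%C * jacobiC n z = z * jacobiC n.+1 z - (a n.+1)%:C%C * jacobiC n.+2 z.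
Proof.
have /(congr1 (fun p => (map_poly (real_complex R) p).[z])) := jacobi_rec n.
by rewrite rmorphB rmorphM /= !map_polyZ /= map_polyX !hornerE.
Qed.

(** Since [a n] is nonzero, the recurrence can be run backwards and carries two consecutive zeros
    down to [q_0 = 1]. *)
Lemma jacobiC_neq0 n z : jacobiC n z = 0 -> jacobiC n.+1 z = 0 -> False.
Proof.
elim: n => [|n IH] h0 h1.
  by move/eqP: h0; rewrite jacobiC0 oner_eq0.
apply: IH => //; apply/eqP.
have := jacobiC_rec n z; rewrite h0 h1 !mulr0 subr0 => /eqP.
by rewrite mulf_eq0 fmorph_eq0 (negPf (an0 n)).
Qed.

(* Christoffel-Darboux on the diagonal [(z, conj z)] *)
Lemma jacobiC_christoffel n z :
  a n * (Im (jacobiC n.+1 z) * Re (jacobiC n z) -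
         Re (jacobiC n.+1 z) * Im (jacobiC n z)) =
  Im z * \sum_(i < n.+1) (Re (jacobiC i z) ^+ 2 + Im (jacobiC i z) ^+ 2).
Proof.
elim: n => [|n IH].
  rewrite big_ord1 jacobiC0 /= expr0n expr1n /= addr0 !mulr1 mulr0 subr0.
  by have := congr1 Im (jacobiC1 z); rewrite complex_ImM /= mulr0 addr0.
have -> : \sum_(i < n.+2) (Re (jacobiC i z) ^+ 2 + Im (jacobiC i z) ^+ 2) =
  \sum_(i < n.+1) (Re (jacobiC i z) ^+ 2 + Im (jacobiC i z) ^+ 2) +
  (Re (jacobiC n.+1 z) ^+ 2 + Im (jacobiC n.+1 z) ^+ 2) by rewrite big_ord_recr.
rewrite [RHS]mulrDr -IH.
have := jacobiC_rec n z.
case: (jacobiC n z) => u v; case: (jacobiC n.+1 z) => u' v'.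
case: (jacobiC n.+2 z) => u'' v''; case: z {IH} => x y; simpc => -[E1 E2] /=.
have -> : a n.+1 * (v'' * u' - u'' * v') =
  (a n.+1 * v'') * u' - (a n.+1 * u'') * v' by ring.
have -> : a n.+1 * v'' = x * v' + y * u' - a n * v by lra.
have -> : a n.+1 * u'' = x * u' - y * v' - a n * u by lra.
by ring.
Qed.

(** At a root [q_(n+1)(z) = i q_n(z)], so the left side of Christoffel-Darboux is [a_n |q_n(z)|^2],
    which is positive, and the sum on its right is at least [1]. *)
Lemma jacobi_upper_roots n z :
  root (map_poly (real_complex R) (q n.+1) -
        'i%C *: map_poly (real_complex R) (q n)) z -> 0 < Im z.
Proof.
rewrite /root hornerD hornerN hornerZ -!/(jacobiC _ z) subr_eq0 => /eqP E.
have := jacobiC_christoffel n z; have := @jacobiC_neq0 n z; rewrite {}E.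
have S1 : 1 <= \sum_(i < n.+1) (Re (jacobiC i z) ^+ 2 + Im (jacobiC i z) ^+ 2).
  rewrite big_ord_recl jacobiC0 /= expr1n expr0n addr0 lerDl.
  by apply: sumr_ge0 => i _; rewrite addr_ge0 ?sqr_ge0.
case: (jacobiC n z) => u v /=; simpc => nz E.
have {}E : a n * (u ^+ 2 + v ^+ 2) = Im z *
  \sum_(i < n.+1) (Re (jacobiC i z) ^+ 2 + Im (jacobiC i z) ^+ 2).
  by rewrite -E; ring.
have uv : u ^+ 2 + v ^+ 2 != 0.
  rewrite paddr_eq0 ?sqr_ge0 // !sqrf_eq0; apply/negP => /andP[/eqP u0 /eqP v0].
  by apply: nz; rewrite u0 v0 ?oppr0.
have : 0 < a n * (u ^+ 2 + v ^+ 2).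
  by rewrite mulr_gt0 // lt_def uv addr_ge0 ?sqr_ge0.
by rewrite E pmulr_lgt0 // (lt_le_trans ltr01 S1).
Qed.

Lemma jacobi_sqr_gt0 n x : 0 < (q n).[x] ^+ 2 + (q n.+1).[x] ^+ 2.
Proof.
rewrite lt_def addr_ge0 ?sqr_ge0 // andbT paddr_eq0 ?sqr_ge0 // !sqrf_eq0.
apply/negP => /andP[/eqP h0 /eqP h1].
apply: (@jacobiC_neq0 n x%:C%C);
  by rewrite /jacobiC horner_map /= ?h0 ?h1 rmorph0.
Qed.

(* Bernstein-Szego weight. *)
Definition bs_weight n x := (pi * (a n * ((q n).[x] ^+ 2 + (q n.+1).[x] ^+ 2)))^-1.

Lemma bs_weight_gt0 n x : 0 < bs_weight n x.
Proof. by rewrite invr_gt0 !mulr_gt0 ?pi_gt0 ?jacobi_sqr_gt0. Qed.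

(** This is [pvi_ratio] for [A = q_(n+1)] and [B = q_n]; the factor [pi * a n] of the weight is
    absorbed by [lead_jacobiS]. *)
Lemma pvi_bs_weight_top n g : (size g <= n.+1)%N ->
  pvi (fun x => g.[x] * (q n.+1).[x] * bs_weight n x) 0 /\
  pvi (fun x => g.[x] * (q n).[x] * bs_weight n x) (g`_n / lead_coef (q n)).
Proof.
move=> sg; have pi0 : pi != 0 :> R by rewrite lt0r_neq0 ?pi_gt0.
have W x : bs_weight n x =
    (pi * a n)^-1 * ((q n.+1).[x] ^+ 2 + (q n).[x] ^+ 2)^-1.
  by rewrite /bs_weight mulrA invfM addrC.
have [|H0 H1] := @pvi_ratio _ (q n.+1) (q n) g n (size_jacobi _) _ (@jacobi_upper_roots n) sg.
  by rewrite size_jacobi.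
split.
  move: H0 => /(pviZ (pi * a n)^-1); rewrite mulr0; congr pvi.
  by apply/funext => x; rewrite W mulrCA.
move: H1 => /(pviZ (pi * a n)^-1); congr pvi.
  by apply/funext => x; rewrite W mulrCA.
rewrite -(lead_jacobiS n); have := lt0r_neq0 (lead_jacobi_gt0 n.+1) => l0.
rewrite (mulrA _ pi) invfM [pi^-1 * _]mulrC mulfVK //.
by rewrite invfM mulrCA.
Qed.

(** Downward induction from [m = n], with the recurrence read backwards as
    [a_m q_m = x q_(m+1) - a_(m+1) q_(m+2)]. The induction also carries that [q_(m+1)] annihilates
    all degrees up to [m], which disposes of the last term. *)
Lemma pvi_bs_weight n m g : (m <= n)%N -> (size g <= m.+1)%N ->
  pvi (fun x => g.[x] * (q m).[x] * bs_weight n x) (g`_m / lead_coef (q m)).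
Proof.
move=> mn; rewrite -(subKn mn); move: (n - m)%N (leq_subr m n) => d {m mn}.
have drop m (h : {poly R}) : (forall g, (size g <= m.+1)%N ->
    pvi (fun x => g.[x] * (q m).[x] * bs_weight n x) (g`_m / lead_coef (q m))) ->
    (size h <= m)%N -> pvi (fun x => h.[x] * (q m).[x] * bs_weight n x) 0.
  move=> H sh; have := H h (leqW sh).
  by rewrite [h`_m]nth_default // mul0r.
suff : (d <= n)%N -> (forall g, (size g <= (n - d).+1)%N ->
    pvi (fun x => g.[x] * (q (n - d)).[x] * bs_weight n x)
        (g`_(n - d) / lead_coef (q (n - d)))) /\
  (forall g, (size g <= (n - d).+1)%N ->
    pvi (fun x => g.[x] * (q (n - d).+1).[x] * bs_weight n x) 0).
  by move=> H /H[]; auto.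
elim: d {g} => [|d IH] dn.
  by rewrite subn0; split => g sg; have [] := pvi_bs_weight_top sg.
have := IH (ltnW dn); have -> : (n - d = (n - d.+1).+1)%N by rewrite subnSK.
move: (n - d.+1)%N => m [IH1 IH2]; split; last by move=> g; apply: drop.
move=> g sg.
have sX : (size (g * 'X)%R <= m.+2)%N.
  by rewrite (leq_trans (size_polyMleq _ _)) // size_polyX addn2.
have := pviD (IH1 _ sX) (pviZ (- a m.+1) (IH2 g (leqW sg))).
move=> /(pviZ (a m)^-1); congr pvi.
  apply/funext => x; rewrite hornerMX.
  rewrite -[(q m).[x]](mulKf (an0 m)) jacobi_horner_rec; ring.
rewrite mulr0 addr0 coefMX /= -(lead_jacobiS m).
by rewrite invfM mulrCA.
Qed.

Lemma pvi_jacobi n i j : (i <= n)%N -> (j <= n)%N ->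
  pvi (fun x => (q i).[x] * (q j).[x] * bs_weight n x) (i == j)%:R.
Proof.
wlog ij : i j / (i <= j)%N => [hw|] ni nj.
  case/orP: (leq_total i j) => ij; first exact: hw.
  rewrite eq_sym; under eq_fun do rewrite [X in X * _]mulrC; exact: hw.
have := @pvi_bs_weight n j (q i) nj; rewrite size_jacobi ltnS => /(_ ij).
congr pvi; have [->|nij] := eqVneq i j.
  have -> : (q j)`_j = lead_coef (q j) by rewrite lead_coefE size_jacobi.
  by rewrite divff // lt0r_neq0 // lead_jacobi_gt0.
rewrite nth_default ?mul0r // size_jacobi.
by rewrite ltn_neqAle nij.
Qed.

End Jacobi.

(** * Moments *)

Section Moments.
Variable R : realType.
Implicit Types (x y c : R) (w : R -> R) (g h : {poly R}).
Local Notation leb := (@lebesgue_measure R).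

(** Monotone convergence along the intervals [[- n, n]], each evaluated by the fundamental theorem
    of calculus; nonnegativity upgrades the principal value to a Lebesgue integral. *)
Lemma ge0_pvi_integral (f : R -> R) (v : R) : (forall x, 0 <= f x) ->
  continuous f -> pvi f v -> (\int[leb]_x (f x)%:E)%E = v%:E.
Proof.
move=> f0 cf [F dF Fv].
have mf (D : set R) : measurable_fun D (EFin \o f).
  apply/measurable_EFinP; apply: measurable_funTS.
  exact: continuous_measurable_fun.
have cF : continuous F.
  move=> x; apply: differentiable_continuous; apply/derivable1_diffP.
  exact: ex_derive.
pose I (n : nat) : set R := `[- (n%:R : R), n%:R]%classic.
have ndI : nondecreasing_seq I.
  move=> m n mn; rewrite subsetEset => x; rewrite /I /= !in_itv /= -!ler_norml.
  by move=> /le_trans; apply; rewrite ler_nat.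
have mI i : measurable (I i) by exact: measurable_itv.
have bI : \bigcup_i I i = [set: R].
  rewrite -subTset => x _; exists (Num.truncn `|x|).+1 => //=.
  by rewrite /I /= in_itv /= -ler_norml ltW // truncnS_gt.
have /cvg_lim := @ge0_nondecreasing_set_cvg_integral _ (measurableTypeR R) R
  I (EFin \o f) leb ndI mI (fun i => mf (I i)) (fun i x _ => f0 x).
rewrite bI => <- //.
apply/cvg_lim => //.
apply: (@cvg_trans _ (EFin (F n%:R - F (- n%:R)) @[n --> \oo])); last first.
  exact: (cvg_comp _ _ Fv).
apply: near_eq_cvg; near=> n.
symmetry; rewrite EFinB; apply: continuous_FTC2.
- rewrite (@lt_trans _ _ 0) // ?oppr_lt0 ltr0n; near: n; exact: nbhs_infty_gt.
- exact: continuous_subspaceT.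
- split.
  + by move=> x _; exact: ex_derive.
  + exact: cvg_at_right_filter (cF _).
  + exact: cvg_at_left_filter (cF _).
- by move=> x _; rewrite derive1E; exact: derive_val.
Unshelve. all: by end_near. Qed.

(** Integrability is recorded with the value so that moments can be added and scaled. *)
Definition has_moment w h v :=
  leb.-integrable setT (fun x => (h.[x] * w x)%:E) /\
  (\int[leb]_x (h.[x] * w x)%:E)%E = v%:E.

Lemma has_momentD w g h u v : has_moment w g u -> has_moment w h v ->
  has_moment w (g + h) (u + v).
Proof.
move=> [ig eg] [ih eh].
have E x : ((g + h).[x] * w x)%:E = ((g.[x] * w x)%:E + (h.[x] * w x)%:E)%E.
  by rewrite hornerD mulrDl EFinD.
split; first by under eq_fun do rewrite E; exact: integrableD.
by under eq_integral do rewrite E; rewrite integralD //= eg eh EFinD.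
Qed.

Lemma has_momentZ w c g u : has_moment w g u -> has_moment w (c *: g) (c * u).
Proof.
move=> [ig eg].
have E x : ((c *: g).[x] * w x)%:E = (c%:E * (g.[x] * w x)%:E)%E.
  by rewrite hornerZ -mulrA EFinM.
split; first by under eq_fun do rewrite E; exact: integrableZl.
by under eq_integral do rewrite E; rewrite integralZl //= eg EFinM.
Qed.

Lemma has_moment0 w : has_moment w 0 0.
Proof.
have E x : (((0 : {poly R}).[x] * w x)%:E = 0)%E by rewrite horner0 mul0r.
split; first by under eq_fun do rewrite E; exact: integrable0.
by under eq_integral do rewrite E; rewrite integral0.
Qed.

Lemma has_moment_sum w n (p : 'I_n -> {poly R}) (v c : 'I_n -> R) :
  (forall i, has_moment w (p i) (v i)) ->
  has_moment w (\sum_i c i *: p i) (\sum_i c i * v i).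
Proof.
move=> H; elim/big_rec2: _; first exact: has_moment0.
by move=> i u g _ IH; apply: has_momentD => //; exact: has_momentZ.
Qed.

Lemma has_moment_inj w g u v : has_moment w g u -> has_moment w g v -> u = v.
Proof. by move=> [_ e1] [_]; rewrite e1 => -[]. Qed.

Lemma poly_in_graded_span (p : nat -> {poly R}) :
  (forall n, size (p n) = n.+1) -> forall n h, (size h <= n)%N ->
  exists c : nat -> R, h = \sum_(i < n) c i *: p i.
Proof.
move=> sp; elim=> [|n IH] h sh.
  exists (fun=> 0); rewrite big_ord0; apply/eqP; rewrite -size_poly_eq0.
  by rewrite -leqn0.
have ln : lead_coef (p n) != 0 by rewrite lead_coef_eq0 -size_poly_eq0 sp.
set d := h`_n / lead_coef (p n).
have [|c Ec] := IH (h - d *: p n).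
  apply/leq_sizeP => j nj; rewrite coefB coefZ.
  move: nj; rewrite leq_eqVlt => /orP[/eqP <-|nj].
    have -> : (p n)`_n = lead_coef (p n) by rewrite lead_coefE sp.
    by rewrite divfK // subrr.
  by rewrite !nth_default ?mulr0 ?subr0 ?sp // (leq_trans sh).
exists (fun i => if i == n then d else c i).
rewrite big_ord_recr /= eqxx -[LHS](subrK (d *: p n)) Ec; congr (_ + _).
by apply: eq_bigr => i _; rewrite ltn_eqF.
Qed.

(** * Moments of the Bernstein-Szego weights *)

Section Jac.
Variable a : nat -> R.
Hypothesis a_gt0 : forall n, 0 < a n.
Local Notation q := (jacobi a).

Lemma continuous_bs_weight n : continuous (bs_weight a n).
Proof.
move=> x; apply: cvgV.
  by rewrite lt0r_neq0 // !mulr_gt0 ?pi_gt0 ?jacobi_sqr_gt0.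
apply: cvgM; first exact: cvg_cst.
pose D := a n *: (q n ^+ 2 + q n.+1 ^+ 2).
have E : (fun y => a n * ((q n).[y] ^+ 2 + (q n.+1).[y] ^+ 2)) = horner D.
  by apply/funext => y; rewrite /D hornerZ hornerD !horner_exp.
have := @continuous_horner _ D x; rewrite -E; exact.
Qed.

(** Principal values become integrals only for nonnegative integrands, so squares are treated first
    and the product is recovered by polarization from [(q_i + q_j)^2], [q_i^2] and [q_j^2]. *)
Lemma bs_weight_orthonormal n i j : (i <= n)%N -> (j <= n)%N ->
  has_moment (bs_weight a n) (q i * q j) (i == j)%:R.
Proof.
move=> ni nj; set W := bs_weight a n.
have cW : continuous W := continuous_bs_weight (n := n).
have cc h : continuous (fun x => h.[x] * W x).
  by move=> x; apply: cvgM; [exact: continuous_horner|exact: cW].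
have pos h v : (forall x, 0 <= h.[x]) -> pvi (fun x => h.[x] * W x) v ->
    has_moment W h v.
  move=> h0 hv; have p0 x : 0 <= h.[x] * W x.
    by rewrite mulr_ge0 // ltW // bs_weight_gt0.
  have E := ge0_pvi_integral p0 (cc h) hv.
  split=> //; apply/integrableP; split.
    by apply/measurable_EFinP; exact: continuous_measurable_fun.
  under eq_integral do rewrite gee0_abs ?lee_fin //.
  by rewrite E ltry.
have P k l : (k <= n)%N -> (l <= n)%N ->
    pvi (fun x => (q k * q l).[x] * W x) (k == l)%:R.
  by move=> nk nl; under eq_fun do rewrite hornerM; exact: pvi_jacobi.
have Hi := pos _ _ (fun x => _) (P i i ni ni).
have Hj := pos _ _ (fun x => _) (P j j nj nj).
have Hij : has_moment W ((q i + q j) ^+ 2) (1 + (i == j)%:R *+ 2 + 1).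
  apply: pos => [x|]; first by rewrite horner_exp sqr_ge0.
  have := pviD (pviD (P i i ni ni) (pviZ 2 (P i j ni nj))) (P j j nj nj).
  rewrite !eqxx mulr_natl; congr pvi; apply/funext => x.
  by rewrite horner_exp hornerD !hornerM; ring.
have sq k x : 0 <= (q k * q k).[x] by rewrite hornerM -expr2 sqr_ge0.
have := has_momentZ 2^-1 (has_momentD Hij (has_momentZ (-1)
  (has_momentD (Hi (sq i)) (Hj (sq j))))).
rewrite !eqxx; congr has_moment.
  rewrite scaleN1r (_ : _ - _ = q i * q j *+ 2); last by ring.
  rewrite -scalerMnr scalerMnl -mulr_natr mulVf ?scale1r //.
by rewrite /=; field.
Qed.

(** Expanding [h] in the [q_i] and pairing with [q_0 = 1], only the coefficient of [q_0] survives,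
    and it does not involve [n]. *)
Lemma bs_weight_moment h : exists v,
  forall n, (size h <= n)%N -> has_moment (bs_weight a n) h v.
Proof.
have [c Ec] := poly_in_graded_span (size_jacobi a_gt0) (leqnn (size h)).
exists (\sum_(i < size h) c i * (val i == 0)%:R) => n hn.
rewrite {1}Ec; apply: has_moment_sum => i.
have := @bs_weight_orthonormal n i 0 _ (leq0n n); rewrite jacobi0 mulr1; apply.
by apply: ltnW; apply: leq_trans hn; exact: ltn_ord.
Qed.
End Jac.
End Moments.

(** * The energy form *)

Section Energy.
Variables (R : realType) (b : nat -> R).
Hypothesis b_gt0 : forall n, 0 < b n.
Hypothesis b_nd : forall n, b n <= b n.+1.
Implicit Types (x y M : R).

Definition paired n := if odd n then Num.sqrt (b n.-1 * b n.+1) else b n.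
Local Notation q := (jacobi paired).
Local Notation beta k := (b k.*2).

Lemma paired_gt0 n : 0 < paired n.
Proof. by rewrite /paired; case: odd => //; rewrite sqrtr_gt0 mulr_gt0. Qed.

Lemma paired_even k : paired k.*2 = beta k.
Proof. by rewrite /paired odd_double. Qed.

Lemma paired_odd k : paired k.*2.+1 ^+ 2 = beta k * beta k.+1.
Proof. by rewrite /paired /= odd_double /= sqr_sqrtr // mulr_ge0 // ltW. Qed.

Lemma b_homo m n : (m <= n)%N -> b m <= b n.
Proof. by move=> mn; apply: (homo_leq (@lexx _ R) (@le_trans _ R)). Qed.

Definition energy k x := beta k * ((q k.*2).[x] ^+ 2 + (q k.*2.+1).[x] ^+ 2) -
  x * (q k.*2).[x] * (q k.*2.+1).[x].

(* The geometric mean in the middle makes both ratios equal, which cancels the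
   first-order growth of the quadratic form. *)
Lemma energy_identity (a a1 a2 x u v w t : R) : 0 < a -> 0 < a1 -> 0 < a2 ->
  a1 ^+ 2 = a * a2 -> a1 * w = x * v - a * u -> a2 * t = x * w - a1 * v ->
  a2 * (w ^+ 2 + t ^+ 2) - x * w * t = a * (u ^+ 2 + v ^+ 2) - x * u * v +
    (1 - a / a2) * (x ^+ 2 * v ^+ 2 / a - x * u * v).
Proof.
move=> /lt0r_neq0 a0 /lt0r_neq0 a10 /lt0r_neq0 a20 E1 E2 E3.
have -> : t = (x * w - a1 * v) / a2 by rewrite -E3 mulrC mulKf.
have -> : w = (x * v - a * u) / a1 by rewrite -E2 mulrC mulKf.
have -> : a2 = a1 ^+ 2 / a by rewrite E1 mulrC mulKf.
by field; rewrite a0 a10.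
Qed.

(** The difference of the two sides is half of [(a + x) (u - v)^2 + (a - x) (u + v)^2]. *)
Lemma form_lower (a x M u v : R) : 0 <= M -> `|x| <= M -> M <= a ->
  a * (u ^+ 2 + v ^+ 2) <= 2 * (a * (u ^+ 2 + v ^+ 2) - x * u * v).
Proof.
move=> M0; rewrite ler_norml => /andP[x1 x2] Ma.
have h1 : 0 <= (a - x) * (u ^+ 2 + v ^+ 2).
  by apply: mulr_ge0; [lra|rewrite addr_ge0 ?sqr_ge0].
have h2 : 0 <= (a + x) * (u ^+ 2 + v ^+ 2).
  by apply: mulr_ge0; [lra|rewrite addr_ge0 ?sqr_ge0].
have h3 : 0 <= (a + x) * (u - v) ^+ 2.
  by apply: mulr_ge0; [lra|exact: sqr_ge0].
have h4 : 0 <= (a - x) * (u + v) ^+ 2.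
  by apply: mulr_ge0; [lra|exact: sqr_ge0].
nra.
Qed.

Lemma form_upper (a x M u v : R) : 0 <= M -> `|x| <= M -> M <= a ->
  a * (u ^+ 2 + v ^+ 2) - x * u * v <= 2 * (a * (u ^+ 2 + v ^+ 2)).
Proof.
move=> M0; rewrite ler_norml => /andP[x1 x2] Ma.
have h3 : 0 <= (a + x) * (u + v) ^+ 2.
  by apply: mulr_ge0; [lra|exact: sqr_ge0].
have h4 : 0 <= (a - x) * (u - v) ^+ 2.
  by apply: mulr_ge0; [lra|exact: sqr_ge0].
have h1 := sqr_ge0 u; have h2 := sqr_ge0 v.
have h5 : 0 <= a * u ^+ 2 by rewrite mulr_ge0 //; lra.
have h6 : 0 <= a * v ^+ 2 by rewrite mulr_ge0 //; lra.
nra.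
Qed.

Lemma cross_bound (x M u v : R) : `|x| <= M ->
  `|x * u * v| <= M / 2 * (u ^+ 2 + v ^+ 2).
Proof.
move=> xM; have M0 : 0 <= M by rewrite (le_trans _ xM).
rewrite -mulrA normrM; have h : `|u * v| <= (u ^+ 2 + v ^+ 2) / 2.
  rewrite ler_norml; have := sqr_ge0 (u + v); have := sqr_ge0 (u - v).
  by move=> h1 h2; apply/andP; split; nra.
rewrite [leRHS](_ : _ = M * ((u ^+ 2 + v ^+ 2) / 2)); last by ring.
exact: ler_pM.
Qed.

Lemma defect_bound (a x M u v : R) : 0 < a -> `|x| <= M -> M <= a ->
  `|x ^+ 2 * v ^+ 2 / a - x * u * v| <=
  3 * M / a * (a * (u ^+ 2 + v ^+ 2) - x * u * v).
Proof.
move=> a0 xM Ma; have M0 : 0 <= M by rewrite (le_trans _ xM).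
have h1 := cross_bound u v xM.
have h2 := form_lower u v M0 xM Ma.
have h3 : `|x ^+ 2 * v ^+ 2 / a| <= M * v ^+ 2.
  have p : 0 <= x ^+ 2 * v ^+ 2 / a.
    by apply: divr_ge0 (ltW a0); apply: mulr_ge0; exact: sqr_ge0.
  rewrite (ger0_norm p) ler_pdivrMr // [leRHS]mulrAC.
  apply: ler_wpM2r; first exact: sqr_ge0.
  rewrite -(@real_normK _ x) ?num_real // expr2.
  by apply: ler_pM => //; exact: le_trans Ma.
apply: le_trans (ler_normB _ _) _.
(* The two terms together are at most [3 M / 2] times [u^2 + v^2]; the factor [2] of [form_lower]
   turns this into [3 M]. *)
have h4 : 3 / 2 * M * (u ^+ 2 + v ^+ 2) <=
    3 * M / a * (a * (u ^+ 2 + v ^+ 2) - x * u * v).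
  have -> : 3 / 2 * M * (u ^+ 2 + v ^+ 2) =
    3 / 2 * M / a * (a * (u ^+ 2 + v ^+ 2)) by field; rewrite lt0r_neq0.
  have -> : 3 * M / a * (a * (u ^+ 2 + v ^+ 2) - x * u * v) =
    3 / 2 * M / a * (2 * (a * (u ^+ 2 + v ^+ 2) - x * u * v)).
    by field; rewrite lt0r_neq0.
  by rewrite ler_wpM2l // divr_ge0 ?(ltW a0) // mulr_ge0.
have h5 : 0 <= M * u ^+ 2 by rewrite mulr_ge0 ?sqr_ge0.
lra.
Qed.

(** The factor [1 - beta k / beta (k+1)] of [energy_identity] times the factor [3 M / beta k] of
    [defect_bound] is exactly a telescoping difference. *)
Lemma energy_step k x M : `|x| <= M -> M <= beta k ->
  `|energy k.+1 x - energy k x| <=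
  energy k x * (3 * M / beta k - 3 * M / beta k.+1).
Proof.
move=> xM Mb; have p n := paired_gt0 n.
have M0 : 0 <= M by rewrite (le_trans _ xM).
have n0 := lt0r_neq0 (b_gt0 k.*2); have n1 := lt0r_neq0 (b_gt0 k.+1.*2).
have r1 := jacobi_horner_rec p k.*2 x; have r2 := jacobi_horner_rec p k.*2.+1 x.
have e2 := paired_even k.+1; rewrite doubleS in e2 n1 *.
rewrite paired_even in r1; rewrite e2 in r2.
have := @energy_identity (beta k) (paired k.*2.+1) (b k.*2.+2) x
  (q k.*2).[x] (q k.*2.+1).[x] (q k.*2.+2).[x] (q k.*2.+3).[x]
  (b_gt0 _) (p _) (b_gt0 _) (paired_odd k).
rewrite /energy doubleS => ->; last 2 first.
- by rewrite r1; ring.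
- by rewrite r2; ring.
rewrite addrC addKr normrM.
have D := defect_bound (q k.*2).[x] (q k.*2.+1).[x] (b_gt0 k.*2) xM Mb.
have c0 : 0 <= 1 - beta k / b k.*2.+2.
  by rewrite subr_ge0 ler_pdivrMr // mul1r b_homo // !leqW.
rewrite (ger0_norm c0); apply: (le_trans (ler_wpM2l c0 D)).
rewrite le_eqVlt; apply/orP; left; apply/eqP; field.
by rewrite n0 n1.
Qed.

Section Window.
Variables (M : R) (K : nat).
Hypothesis M0 : 0 <= M.
Hypothesis MK : 6 * M <= beta K.

(** The threshold [6 * M <= beta K] keeps this error at most [1 / 2] from index [K] on. *)
Let e k := 3 * M / beta k.

Lemma window_le k : (K <= k)%N -> 6 * M <= beta k.
Proof. by move=> Kk; rewrite (le_trans MK) // b_homo // leq_double. Qed.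

Lemma window_M k : (K <= k)%N -> M <= beta k.
Proof. by move=> /window_le; have := M0; lra. Qed.

Let e_ge0 k : 0 <= e k.
Proof. by rewrite /e divr_ge0 ?mulr_ge0 // ltW. Qed.

Let e_half k : (K <= k)%N -> e k <= 1 / 2.
Proof. by move=> /window_le h; rewrite /e ler_pdivrMr //; lra. Qed.

Lemma energy_ge k x : (K <= k)%N -> `|x| <= M ->
  beta k * ((q k.*2).[x] ^+ 2 + (q k.*2.+1).[x] ^+ 2) <= 2 * energy k x.
Proof. by move=> Kk xM; apply: form_lower (window_M Kk). Qed.

Lemma energy_le k x : (K <= k)%N -> `|x| <= M ->
  energy k x <= 2 * (beta k * ((q k.*2).[x] ^+ 2 + (q k.*2.+1).[x] ^+ 2)).
Proof. by move=> Kk xM; apply: form_upper (window_M Kk). Qed.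

Lemma energy_gt0 k x : (K <= k)%N -> `|x| <= M -> 0 < energy k x.
Proof.
move=> Kk xM; rewrite -(@pmulr_rgt0 _ 2) //; apply: lt_le_trans (energy_ge Kk xM).
by rewrite mulr_gt0 // jacobi_sqr_gt0 //; exact: paired_gt0.
Qed.

(** Correction factors turn the two-sided step estimate into monotone sequences. With [s = e k] and
    [t = e k.+1] the slack is at least [E t (s - t)] in the first inequality and
    [E (1 - 2 t) (s - t)] in the second, the latter nonnegative because [t <= 1 / 2]. *)
Lemma energy_mono k x : (K <= k)%N -> `|x| <= M ->
  energy k x * (1 - e k) <= energy k.+1 x * (1 - e k.+1) /\
  energy k.+1 x * (1 + 2 * e k.+1) <= energy k x * (1 + 2 * e k).
Proof.
move=> Kk xM; have := energy_step xM (window_M Kk).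
rewrite -/(e k) -/(e k.+1).
have E0 := energy_gt0 Kk xM; have e1 := e_ge0 k; have e2 := e_ge0 k.+1.
have e3 := e_half Kk; have e4 := e_half (leqW Kk).
have d0 : 0 <= e k - e k.+1.
  rewrite /e -mulrBr mulr_ge0 ?mulr_ge0 // subr_ge0 lef_pV2 ?posrE //.
  by apply: b_homo; rewrite leq_double.
move: (energy k x) (energy k.+1 x) (e k) (e k.+1) E0 e1 e2 e3 e4 d0.
move=> E E' s t E0 s0 t0 s1 t1 d0; rewrite ler_norml => /andP[l1 l2].
have g1 : 0 <= (E' - E + E * (s - t)) * (1 - t) by rewrite mulr_ge0 //; lra.
have g2 : 0 <= (E * (s - t) - (E' - E)) * (1 + 2 * t) by rewrite mulr_ge0 //; lra.
have g3 : 0 <= E * (s - t) * t by rewrite !mulr_ge0 // ltW.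
have g4 : 0 <= E * (s - t) * (1 - 2 * t) by rewrite !mulr_ge0 ?(ltW E0) //; lra.
by split; nra.
Qed.

(** Iterates [energy_mono] from [K]; since [e K <= 1 / 2], the factors [1 - e K] and [1 + 2 * e K]
    are replaced by [1 / 2] and [2]. *)
Lemma energy_window k x : (K <= k)%N -> `|x| <= M ->
  energy K x / 2 <= energy k x * (1 - e k) /\ energy k x <= 2 * energy K x.
Proof.
move=> Kk xM.
have H : energy K x * (1 - e K) <= energy k x * (1 - e k) /\
    energy k x * (1 + 2 * e k) <= energy K x * (1 + 2 * e K).
  elim: k Kk => [|k IH]; first by rewrite leqn0 => /eqP ->.
  rewrite leq_eqVlt => /orP[/eqP -> //|]; rewrite ltnS => Kk.
  have [h1 h2] := IH Kk; have [h3 h4] := energy_mono Kk xM.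
  by split; [exact: le_trans h3|exact: le_trans h2].
have E0 := energy_gt0 Kk xM; have E1 := energy_gt0 (leqnn K) xM.
have e1 := e_ge0 k; have e2 := e_ge0 K; have e3 := e_half (leqnn K).
have g1 : 0 <= energy k x * e k by rewrite mulr_ge0 // ltW.
have g2 : 0 <= energy K x * (1 / 2 - e K) by rewrite mulr_ge0 ?(ltW E1) // subr_ge0.
by case: H => h1 h2; split; nra.
Qed.

End Window.
End Energy.

(** * Passage to the limit *)

Section MomentLimit.
Variable R : realType.
Implicit Types (x y c M : R) (g h : {poly R}).
Local Notation leb := (@lebesgue_measure R).

Lemma measurable_horner (D : set R) h : measurable_fun D (horner h).
Proof.
by apply: measurable_funTS; apply: continuous_measurable_fun; exact: continuous_horner.
Qed.

Lemma integrable_dominated (f g : R -> R) : measurable_fun setT f ->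
  leb.-integrable setT (EFin \o g) -> (forall x, `|f x| <= g x) ->
  leb.-integrable setT (EFin \o f).
Proof.
move=> mf ig fg; apply: (le_integrable _ _ _ ig) => //.
  exact/measurable_EFinP.
by move=> x _ /=; rewrite lee_fin (le_trans (fg x)) // ler_norm.
Qed.

Lemma ge0_integrableP (f : R -> R) : measurable_fun setT f -> (forall x, 0 <= f x) ->
  (\int[leb]_x (f x)%:E < +oo)%E -> leb.-integrable setT (EFin \o f).
Proof.
move=> mf f0 fi; apply/integrableP; split; first exact/measurable_EFinP.
by under eq_integral do rewrite /= ger0_norm //.
Qed.

(** Replaces a polynomial of variable sign by a nonnegative polynomial majorant, to which Fatou's
    lemma applies. *)
Lemma horner_le_1sqr h x : `|h.[x]| <= (1 + h ^+ 2).[x].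
Proof.
rewrite hornerD hornerC horner_exp -[h.[x] ^+ 2]real_normK ?num_real //.
have := sqr_ge0 (`|h.[x]| - 1); have := normr_ge0 h.[x]; nra.
Qed.

Section Tail.
Variables (w : R -> R) (h : {poly R}) (M : R).
Hypothesis mw : measurable_fun setT w.
Hypothesis w_ge0 : forall x, 0 <= w x.
Hypothesis M_gt0 : 0 < M.

Definition window (x : R) : R := (\1_(`[- M, M]%classic : set R) : R -> R) x.
(** Outside [[- M, M]] one has [|h| <= 1 + h^2 <= M^-2 x^2 (1 + h^2)], so a single higher moment
    controls the tail of [h]. *)
Definition tail_poly := 'X ^+ 2 * (1 + h ^+ 2).

Lemma windowE (x : R) : window x = (`|x| <= M)%R%:R.
Proof. by rewrite /window indicE mem_setE in_itv /= -ler_norml. Qed.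

Lemma measurable_window : measurable_fun setT window.
Proof. by apply: measurable_indic. Qed.

Lemma tail_bound x : `|h.[x] * w x - h.[x] * w x * window x| <=
  M ^- 2 * (tail_poly.[x] * w x).
Proof.
have tp : tail_poly.[x] = x ^+ 2 * (1 + h ^+ 2).[x].
  by rewrite /tail_poly hornerM horner_exp hornerX.
have h1 := horner_le_1sqr h x.
have h0 : 0 <= (1 + h ^+ 2).[x] by apply: le_trans h1.
rewrite windowE; case: (leP `|x| M) => xM.
  rewrite mulr1 subrr normr0 tp mulr_ge0 ?invr_ge0 ?sqr_ge0 //.
  by apply: mulr_ge0 => //; apply: mulr_ge0 => //; exact: sqr_ge0.
rewrite mulr0 subr0 normrM (ger0_norm (w_ge0 x)) mulrA ler_wpM2r // tp mulrA.
apply: (le_trans h1); rewrite ler_peMl // ler_pdivlMl ?exprn_gt0 // mulr1.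
by rewrite -(@real_normK _ x) ?num_real // lerXn2r ?nnegrE // ltW.
Qed.

Lemma Rintegral_tail V : leb.-integrable setT (fun x => (h.[x] * w x)%:E) ->
  leb.-integrable setT (fun x => (tail_poly.[x] * w x)%:E) ->
  \int[leb]_x (tail_poly.[x] * w x) <= V ->
  `|\int[leb]_x (h.[x] * w x) - \int[leb]_x (h.[x] * w x * window x)|
    <= V / M ^+ 2.
Proof.
move=> ih it tV.
have mf : measurable_fun setT (fun x => h.[x] * w x).
  by apply: measurable_funM => //; exact: measurable_horner.
have iw : leb.-integrable setT (EFin \o (fun x => h.[x] * w x * window x)).
  apply: (@integrable_dominated _ (fun x => `|h.[x] * w x|)).
  - by apply: measurable_funM => //; exact: measurable_window.
  - exact: integrable_norm.
  - move=> x; rewrite normrM windowE ler_piMr //.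
    by rewrite ger0_norm ?ler0n // lern1 leq_b1.
have iB : leb.-integrable setT
    (EFin \o (fun x => h.[x] * w x - h.[x] * w x * window x)).
  apply: eq_integrable (integrableB _ ih iw) => //.
rewrite -RintegralB //; apply: le_trans (le_normr_Rintegral _ _) _ => //.
apply: (@le_trans _ _ (\int[leb]_x (M ^- 2 * (tail_poly.[x] * w x)))).
  apply: le_Rintegral => //.
  - exact: integrable_norm.
  - exact: (integrableZl measurableT (M ^- 2) it).
  - by move=> x _; exact: tail_bound.
by rewrite RintegralZl // mulrC ler_wpM2r // invr_ge0 exprn_ge0 // ltW.
Qed.
End Tail.

Section Limit.
Variables (wk : nat -> R -> R) (w : R -> R).
Hypothesis mwk : forall k, measurable_fun setT (wk k).
Hypothesis wk_ge0 : forall k x, 0 <= wk k x.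
Hypothesis wk_cvg : forall x, wk k x @[k --> \oo] --> w x.

Lemma limit_weight_measurable : measurable_fun setT w.
Proof. by apply: (measurable_fun_cvg mwk) => x _; exact: wk_cvg. Qed.

Lemma limit_weight_ge0 x : 0 <= w x.
Proof. by apply: (cvgr_to_ge (@wk_cvg x)); exact: nearW. Qed.

(** Fatou's lemma loses equality, but the inequality suffices for integrability and for tail bounds
    against the limit weight. *)
Lemma fatou_moment h v K : (forall x, 0 <= h.[x]) ->
  (forall k, (K <= k)%N -> has_moment (wk k) h v) ->
  leb.-integrable setT (fun x => (h.[x] * w x)%:E) /\
  (\int[leb]_x (h.[x] * w x)%:E <= v%:E)%E.
Proof.
move=> h0 hm; have mh k : measurable_fun setT (fun x => h.[x] * wk k x).
  by apply: measurable_funM => //; exact: measurable_horner.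
suff Le : (\int[leb]_x (h.[x] * w x)%:E <= v%:E)%E.
  split=> //; apply: ge0_integrableP.
  - by apply: measurable_funM; [exact: measurable_horner|exact: limit_weight_measurable].
  - by move=> x; rewrite mulr_ge0 // limit_weight_ge0.
  - by apply: le_lt_trans Le _; rewrite ltry.
have := @fatou _ (measurableTypeR R) R leb setT measurableT
  (fun k x => (h.[x] * wk (k + K)%N x)%:E)
  (fun k => proj2 (measurable_EFinP _ _) (mh (k + K)%N))
  (fun k x _ => mulr_ge0 (h0 x) (wk_ge0 (k + K)%N x)).
have -> : limn_einf (fun k => \int[leb]_x (h.[x] * wk (k + K)%N x)%:E)%E = v%:E.
  under eq_fun => k do rewrite (proj2 (hm (k + K)%N (leq_addl k K))).
  exact: (fst (cvg_limn_einf_sup (cvg_cst _))).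
congr (_ <= _)%E; apply: eq_integral => x _.
apply: (fst (cvg_limn_einf_sup _)).
apply: cvg_EFin; first by apply: nearW.
apply: cvgM; first exact: cvg_cst.
have := @wk_cvg x; rewrite -(cvg_shiftn K); exact.
Qed.

Hypothesis wk_bound : forall M, exists B K, forall k x, (K <= k)%N -> `|x| <= M ->
  wk k x <= B.
Hypothesis wk_moment : forall h, exists v K, forall k, (K <= k)%N ->
  has_moment (wk k) h v.

Lemma limit_weight_integrable h : leb.-integrable setT (fun x => (h.[x] * w x)%:E).
Proof.
have [v [K hv]] := wk_moment (1 + h ^+ 2).
have [|i1 _] := @fatou_moment (1 + h ^+ 2) v K _ hv.
  by move=> x; apply: le_trans (horner_le_1sqr h x).
apply: (integrable_dominated _ i1) => [|x].
  by apply: measurable_funM; [exact: measurable_horner|exact: limit_weight_measurable].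
rewrite normrM (ger0_norm (limit_weight_ge0 x)) ler_wpM2r ?limit_weight_ge0 //.
exact: horner_le_1sqr.
Qed.

(** Dominated convergence on a compact interval, the majorant coming from the local bound on the
    weights and the maximum of [h^2] there. *)
Lemma cvg_window_integral h M : 0 < M ->
  \int[leb]_x (h.[x] * wk k x * window M x) @[k --> \oo] -->
  \int[leb]_x (h.[x] * w x * window M x).
Proof.
move=> M0; have [B [K hB]] := wk_bound M.
have [c _ hc] : exists2 c, c \in `[- M, M]%R &
    forall t, t \in `[- M, M]%R -> (h ^+ 2).[t] <= (h ^+ 2).[c].
  apply: EVT_max; first by rewrite ge0_cp // ltW.
  by apply: continuous_subspaceT => x; exact: continuous_horner.
pose H := (1 + (h ^+ 2).[c]) * B.
have dom k x : (K <= k)%N -> `|h.[x] * wk k x * window M x| <= H * window M x.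
  move=> Kk; rewrite windowE; case: (leP `|x| M) => xM; last by rewrite !mulr0 normr0.
  rewrite !mulr1 normrM (ger0_norm (wk_ge0 k x)) /H.
  apply: ler_pM => //; last exact: hB.
  apply: (le_trans (horner_le_1sqr h x)); rewrite hornerD hornerC lerD2l.
  by apply: hc; rewrite in_itv /= -ler_norml.
have mf k : measurable_fun setT (fun x => h.[x] * wk k x * window M x).
  apply: measurable_funM; last exact: measurable_window.
  by apply: measurable_funM => //; exact: measurable_horner.
have iH : leb.-integrable setT (fun x => (H * window M x)%:E).
  under eq_fun do rewrite EFinM; apply: integrableZl => //.
  exact: integrable_indic_itv.
have Cx x : (h.[x] * wk k x * window M x)%:E @[k --> \oo] -->
    (h.[x] * w x * window M x)%:E.
  apply: cvg_EFin; first by apply: nearW.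
  by apply: cvgM; [apply: cvgM; [exact: cvg_cst|exact: wk_cvg]|exact: cvg_cst].
have CxK x : setT x -> (h.[x] * wk (k + K)%N x * window M x)%:E @[k --> \oo] -->
    (h.[x] * w x * window M x)%:E.
  by move=> _; have := Cx x; rewrite -(cvg_shiftn K); exact.
have C := @dominated_cvg _ (measurableTypeR R) R leb setT measurableT
  (fun k x => (h.[x] * wk (k + K)%N x * window M x)%:E)
  (fun x => (h.[x] * w x * window M x)%:E) (fun x => (H * window M x)%:E)
  (fun k => proj2 (measurable_EFinP _ _) (mf (k + K)%N))
  CxK (fun _ _ => isT) iH (fun k x _ => dom (k + K)%N x (leq_addl k K)).
rewrite -(cvg_shiftn K); apply: fine_cvg; rewrite fineK //.
apply: integrable_fin_num => //; apply: (integrable_dominated _ iH).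
  apply: measurable_funM; last exact: measurable_window.
  by apply: measurable_funM; [exact: measurable_horner|exact: limit_weight_measurable].
move=> x; have Cn : `|h.[x] * wk k x * window M x| @[k --> \oo] -->
    `|h.[x] * w x * window M x|.
  apply: cvg_norm.
  by apply: cvgM; [apply: cvgM; [exact: cvg_cst|exact: wk_cvg]|exact: cvg_cst].
apply: (cvgr_to_le Cn); near=> k; apply: dom; near: k; exact: nbhs_infty_ge.
Unshelve. all: by end_near. Qed.

(** Truncation to [[- M, M]] costs at most [V / M^2], both for [w] and uniformly for the late
    [wk k], where [V] is the stable moment of [tail_poly h]; the truncated integrals converge. *)
Lemma moment_limit h v K : (forall k, (K <= k)%N -> has_moment (wk k) h v) ->
  has_moment w h v.
Proof.
move=> hm; have ih := limit_weight_integrable h; split=> //.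
rewrite -[LHS]fineK; last exact: integrable_fin_num.
congr EFin; rewrite -/(Rintegral _ _ _).
have [V [L hV]] := wk_moment (tail_poly h).
have t0 x : 0 <= (tail_poly h).[x].
  rewrite hornerM horner_exp hornerX mulr_ge0 ?sqr_ge0 //.
  exact: le_trans (horner_le_1sqr h x).
have [it tV] := fatou_moment t0 hV.
have itf := integrable_fin_num measurableT it.
have tV' : \int[leb]_x ((tail_poly h).[x] * w x) <= V.
  by rewrite -lee_fin fineK.
apply/eqP; rewrite -subr_eq0 -normr_le0; apply/ler_addgt0Pl => e e0.
rewrite addr0.
have V0 : 0 <= V by apply: le_trans tV'; apply: Rintegral_ge0 => x _; rewrite mulr_ge0 // limit_weight_ge0.
(* Chosen so that [2 V <= e M]; the added [1] gives [M <= M^2], whence [V / M^2 <= e / 2]. *)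
pose M := 2 * V / e + 1.
have M1 : 1 <= M by rewrite lerDr divr_ge0 ?mulr_ge0 // ltW.
have M0 : 0 < M by rewrite (lt_le_trans _ M1).
have bd : V / M ^+ 2 <= e / 2.
  rewrite ler_pdivrMr ?exprn_gt0 //.
  have : 2 * V <= e * M by rewrite /M mulrDr mulr1 mulrCA divff ?lt0r_neq0 // mulr1 lerDl ltW.
  have : M <= M ^+ 2 by rewrite expr2 ler_peMl // ltW.
  move=> a1 a2; have : e * M <= e * M ^+ 2 by rewrite ler_wpM2l // ltW.
  lra.
have T1 := Rintegral_tail (limit_weight_measurable) limit_weight_ge0 M0 ih it tV'.
have C := @cvg_window_integral h M M0.
have T2 : `|v - \int[leb]_x (h.[x] * w x * window M x)| <= V / M ^+ 2.
  have Cn : `|v - \int[leb]_x (h.[x] * wk k x * window M x)| @[k --> \oo] -->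
      `|v - \int[leb]_x (h.[x] * w x * window M x)|.
    by apply: cvg_norm; apply: cvgB => //; exact: cvg_cst.
  apply: (cvgr_to_le Cn); near=> k.
  have Kk : (K <= k)%N by near: k; exact: nbhs_infty_ge.
  have Lk : (L <= k)%N by near: k; exact: nbhs_infty_ge.
  have [ihk ehk] := hm k Kk; have [itk etk] := hV k Lk.
  have := Rintegral_tail (mwk k) (wk_ge0 k) M0 ihk itk.
  by rewrite {1 2}/Rintegral etk ehk /=; apply.
apply: (le_trans (ler_distD (\int[leb]_x (h.[x] * w x * window M x)) _ _)).
rewrite [leRHS](splitr e) [X in _ + X]distrC.
by apply: lerD; [apply: le_trans T1 bd|apply: le_trans T2 bd].
Unshelve. all: by end_near. Qed.
End Limit.
End MomentLimit.

(** * Convergence of the energy and local bounds *)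

Section EnergyLimit.
Variables (R : realType) (b : nat -> R).
Hypothesis b_gt0 : forall n, 0 < b n.
Hypothesis b_nd : forall n, b n <= b n.+1.
Hypothesis b_cvg : b @ \oo --> +oo.
Implicit Types (x y M : R).
Local Notation q := (jacobi (paired b)).
Local Notation beta k := (b k.*2).
Local Notation energy := (energy b).

(** The energy without its cross term; [pi] times it is the reciprocal of the Bernstein-Szego weight
    of index [k.*2]. *)
Definition form_poly k : {poly R} := beta k *: (q k.*2 ^+ 2 + q k.*2.+1 ^+ 2).

Lemma form_polyE k x :
  (form_poly k).[x] = beta k * ((q k.*2).[x] ^+ 2 + (q k.*2.+1).[x] ^+ 2).
Proof. by rewrite /form_poly hornerZ hornerD !horner_exp. Qed.

Lemma form_poly_gt0 k x : 0 < (form_poly k).[x].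
Proof.
by rewrite form_polyE mulr_gt0 // jacobi_sqr_gt0 // => n; exact: paired_gt0.
Qed.

Lemma window_start M : exists K, 6 * M <= beta K.
Proof.
have /cvgryPge/(_ (6 * M))[N _ H] := b_cvg.
by exists N; apply: H => /=; rewrite -addnn leq_addr.
Qed.

Lemma cvg_energy_error (c : R) : c / beta k @[k --> \oo] --> 0.
Proof.
rewrite -[0](mulr0 c); apply: cvgM; first exact: cvg_cst.
apply/gtr0_cvgV0; first by apply: nearW.
apply/cvgryPge => A; have /cvgryPge/(_ A)[N _ H] := b_cvg.
exists N => // k /= Nk; apply: H => /=.
by rewrite (leq_trans Nk) // -addnn leq_addr.
Qed.

(** The corrected energies [energy k x * (1 - e k)] increase, are bounded above, and stay above
    [energy K x / 2]; as [e k] tends to [0], the energies have the same positive limit. The cross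
    term is of order [1 / beta k] and disappears. *)
Lemma form_poly_cvg x : exists2 S : R, 0 < S & (form_poly k).[x] @[k --> \oo] --> S.
Proof.
have M0 := normr_ge0 x; have [K MK] := window_start `|x|; set M := `|x| in M0 MK.
have xM : `|x| <= M by [].
have W k (Kk : (K <= k)%N) := energy_window b_gt0 b_nd M0 MK Kk xM.
pose e k := 3 * M / beta k.
have e0 : e k @[k --> \oo] --> 0 by exact: cvg_energy_error.
pose u n := energy (n + K)%N x * (1 - e (n + K)%N).
have ub n : u n <= 2 * energy K x.
  have Kn := leq_addl n K; have [_ h2] := W _ Kn.
  have E0 := energy_gt0 b_gt0 b_nd M0 MK Kn xM.
  apply: le_trans h2; rewrite /u ler_piMr ?(ltW E0) // gerBl.
  by rewrite /e divr_ge0 ?mulr_ge0 // ltW.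
have cu : cvgn u.
  apply: nondecreasing_is_cvgn; last by exists (2 * energy K x) => _ [n _ <-].
  apply/nondecreasing_seqP => n; rewrite /u addSn.
  by have [] := energy_mono b_gt0 b_nd M0 MK (leq_addl n K) xM.
have E0 : 0 < energy K x by exact: (energy_gt0 b_gt0 b_nd M0 MK).
have lim0 : 0 < limn u.
  apply: (@lt_le_trans _ _ (energy K x / 2)); first by rewrite divr_gt0.
  apply: limr_ge => //; apply: nearW => n.
  by have [] := W _ (leq_addl n K).
have cE : energy k x @[k --> \oo] --> limn u.
  rewrite -(cvg_shiftn K).
  have e1 : 1 - e (n + K)%N @[n --> \oo] --> (1 : R).
    rewrite -[X in _ --> X](subr0 1); apply: cvgB; first exact: cvg_cst.
    by have := e0; rewrite -(cvg_shiftn K); exact.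
  have eu : u n / (1 - e (n + K)%N) @[n --> \oo] --> limn u.
    rewrite -[X in _ --> X]divr1; apply: cvgM => //.
    by apply: cvgV => //; exact: oner_neq0.
  apply: cvg_trans eu; apply: near_eq_cvg; near=> n.
  rewrite /u /= mulfK // subr_eq0 eq_sym lt_eqF //.
  rewrite /e ltr_pdivrMr // mul1r.
  have := window_le b_nd MK (leq_addl n K).
  have := M0; have := b_gt0 (n + K).*2; lra.
exists (limn u) => //.
rewrite -[X in _ --> X]addr0.
have E k : (form_poly k).[x] = energy k x + x * (q k.*2).[x] * (q k.*2.+1).[x].
  by rewrite form_polyE; exact/esym/subrK.
under eq_fun do rewrite E; apply: cvgD => //.
apply: norm_cvg0.
have G : \forall k \near \oo, 0 <= `|x * (q k.*2).[x] * (q k.*2.+1).[x]| <=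
    2 * M * energy K x / beta k.
  near=> k; rewrite normr_ge0 /=.
  have Kk : (K <= k)%N by near: k; exact: nbhs_infty_ge.
  apply: (le_trans (cross_bound _ _ xM)).
  have h1 := energy_ge b_nd M0 MK Kk xM; have [_ h2] := W _ Kk.
  rewrite ler_pdivlMr //.
  rewrite [leLHS](_ : _ = M / 2 * (beta k * ((q k.*2).[x] ^+ 2 + (q k.*2.+1).[x] ^+ 2))); last by ring.
  rewrite [leRHS](_ : _ = M / 2 * (2 * (2 * energy K x))); last by field.
  rewrite ler_wpM2l ?divr_ge0 //; lra.
exact: (squeeze_cvgr G (cvg_cst _) (cvg_energy_error _)).
Unshelve. all: by end_near. Qed.

(** The [8] collects three factors [2]: from the form to the energy, between the energies at [k] and
    [K], and back to the form. *)
Lemma form_poly_window M : 0 <= M -> exists K, forall k x, (K <= k)%N ->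
  `|x| <= M -> (form_poly K).[x] <= 8 * (form_poly k).[x] /\
  (form_poly k).[x] <= 8 * (form_poly K).[x].
Proof.
move=> M0; have [K MK] := window_start M; exists K => k x Kk xM.
have [w1 w2] := energy_window b_gt0 b_nd M0 MK Kk xM.
have h1 := energy_ge b_nd M0 MK Kk xM.
have h2 := energy_le b_nd M0 MK Kk xM.
have h3 := energy_ge b_nd M0 MK (leqnn K) xM.
have h4 := energy_le b_nd M0 MK (leqnn K) xM.
rewrite -!form_polyE in h1 h2 h3 h4.
have e0 : 0 <= energy k x * (3 * M / beta k).
  by rewrite mulr_ge0 ?divr_ge0 ?mulr_ge0 ?(ltW (b_gt0 _)) // ltW // (energy_gt0 b_gt0 b_nd M0 MK).
by split; lra.
Qed.

Lemma bs_weight_form k x : bs_weight (paired b) k.*2 x = (pi * (form_poly k).[x])^-1.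
Proof. by rewrite /bs_weight form_polyE paired_even. Qed.

Lemma poly_min_gt0 (p : {poly R}) M : 0 <= M -> (forall x, 0 < p.[x]) ->
  exists2 c, 0 < c & forall x, `|x| <= M -> c <= p.[x].
Proof.
move=> M0 p0; have [c _ hc] : exists2 c, c \in `[- M, M]%R &
    forall t, t \in `[- M, M]%R -> p.[c] <= p.[t].
  apply: EVT_min; first by rewrite ge0_cp.
  by apply: continuous_subspaceT => x; exact: continuous_horner.
by exists p.[c] => // x xM; apply: hc; rewrite in_itv /= -ler_norml.
Qed.

Lemma poly_max (p : {poly R}) M : 0 <= M ->
  exists c, forall x, `|x| <= M -> p.[x] <= c.
Proof.
move=> M0; have [c _ hc] : exists2 c, c \in `[- M, M]%R &
    forall t, t \in `[- M, M]%R -> p.[t] <= p.[c].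
  apply: EVT_max; first by rewrite ge0_cp.
  by apply: continuous_subspaceT => x; exact: continuous_horner.
by exists p.[c] => x xM; apply: hc; rewrite in_itv /= -ler_norml.
Qed.

Lemma bs_weight_locally_bounded M : exists B K, forall k x, (K <= k)%N ->
  `|x| <= M -> bs_weight (paired b) k.*2 x <= B.
Proof.
have [M0|M0] := leP 0 M; last first.
  by exists 0, 0 => k x _ xM; have := le_trans (normr_ge0 x) xM; rewrite leNgt M0.
have [K HK] := form_poly_window M0.
have [c c0 hc] := poly_min_gt0 M0 (form_poly_gt0 K).
exists (pi * (c / 8))^-1, K => k x Kk xM; rewrite bs_weight_form.
have pi0 := pi_gt0 R.
rewrite lef_pV2 ?posrE ?mulr_gt0 ?form_poly_gt0 ?divr_gt0 // ler_wpM2l ?(ltW pi0) //.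
have := hc x xM; have [h _] := HK k x Kk xM; lra.
Qed.

Lemma jacobi_locally_bounded rho M : (forall n, b n.+1 <= rho * b n) ->
  exists B, forall n x, `|x| <= M -> b n * (q n).[x] ^+ 2 <= B.
Proof.
move=> br; have [M0|M0] := leP 0 M; last first.
  by exists 0 => n x xM; have := le_trans (normr_ge0 x) xM; rewrite leNgt M0.
have rho1 : 1 <= rho.
  by rewrite -(ler_pM2r (b_gt0 0)) mul1r (le_trans (b_nd 0)).
have [K HK] := form_poly_window M0.
(* The sum dominates the indices below [K.*2] and the last term all others; [rho] compares [b] at an
   odd index with the even index before it. *)
pose P := \sum_(i < K.*2) b i *: (q i) ^+ 2 + (rho * 8) *: form_poly K.
have [c hc] := poly_max P M0; exists c => n x xM; apply: le_trans (hc x xM).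
rewrite /P hornerD horner_sum hornerZ.
have t0 i : 0 <= (b i *: q i ^+ 2).[x].
  by rewrite hornerZ horner_exp mulr_ge0 ?sqr_ge0 // ltW.
have s0 : 0 <= \sum_(i < K.*2) (b i *: q i ^+ 2).[x] by apply: sumr_ge0.
have f0 := form_poly_gt0 K x.
have [nK|nK] := ltnP n K.*2.
  rewrite (bigD1 (Ordinal nK)) //= hornerZ horner_exp -addrA lerDl addr_ge0 //.
    exact: sumr_ge0.
  by rewrite !mulr_ge0 ?(ltW f0) // (le_trans ler01).
apply: (@le_trans _ _ (rho * 8 * (form_poly K).[x])); last by rewrite lerDr.
have Kk : (K <= n./2)%N by rewrite -(doubleK K) half_leq.
have [_ h] := HK _ x Kk xM.
have := odd_double_half n; move: (n./2) Kk h => k Kk h nE.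
have rho0 : 0 <= rho by apply: le_trans rho1.
have r0 : 0 <= rho * beta k by rewrite mulr_ge0 // ltW.
have : rho * (form_poly k).[x] <= rho * 8 * (form_poly K).[x].
  by rewrite -mulrA ler_wpM2l // (le_trans ler01).
apply: le_trans; rewrite form_polyE mulrA -nE; case: (odd n) => /=.
  rewrite add1n; apply: (@le_trans _ _ (rho * beta k * (q k.*2.+1).[x] ^+ 2)).
    by rewrite ler_wpM2r ?sqr_ge0.
  by rewrite ler_wpM2l // lerDr sqr_ge0.
rewrite add0n; apply: (@le_trans _ _ (rho * beta k * (q k.*2).[x] ^+ 2)).
  by rewrite ler_wpM2r ?sqr_ge0 // ler_peMl // ltW.
by rewrite ler_wpM2l // lerDl sqr_ge0.
Qed.
End EnergyLimit.

(** * Closure of the polynomials in L^2 *)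

Section Closure.
Variable R : realType.
Implicit Types (x y t c : R) (f g h : R -> R) (p : {poly R}).
Local Notation leb := (@lebesgue_measure R).
Variable w : R -> R.
Hypothesis mw : measurable_fun setT w.
Hypothesis w_ge0 : forall x, 0 <= w x.
Hypothesis w_poly : forall p, leb.-integrable setT (fun x => (p.[x] * w x)%:E).

Definition sqdist f g := (\int[leb]_x ((f x - g x) ^+ 2 * w x)%:E)%E.

Lemma sqdist_measurable f g : measurable_fun setT f -> measurable_fun setT g ->
  measurable_fun setT (fun x => (f x - g x) ^+ 2 * w x).
Proof.
move=> mf mg; apply: measurable_funM => //.
by apply: measurable_funX; exact: measurable_funB.
Qed.

(** The inequality [(u + v)^2 <= 2 u^2 + 2 v^2] replaces the triangle inequality and avoids square
    roots and finiteness conditions. *)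
Lemma sqdist_le f g h : measurable_fun setT f -> measurable_fun setT g ->
  measurable_fun setT h ->
  (sqdist f h <= 2%:E * sqdist f g + 2%:E * sqdist g h)%E.
Proof.
move=> mf mg mh; have m1 := sqdist_measurable mf mg.
have m2 := sqdist_measurable mg mh; have m3 := sqdist_measurable mf mh.
have p u v x : (0 <= ((u x - v x) ^+ 2 * w x)%:E)%E.
  by rewrite lee_fin mulr_ge0 // sqr_ge0.
rewrite /sqdist -!ge0_integralZl_EFin //; last 2 first.
- exact/measurable_EFinP.
- exact/measurable_EFinP.
rewrite -ge0_integralD //; last 4 first.
- by move=> x _; rewrite mule_ge0.
- by apply: measurable_funeM; exact/measurable_EFinP.
- by move=> x _; rewrite mule_ge0.
- by apply: measurable_funeM; exact/measurable_EFinP.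
apply: ge0_le_integral => //.
- exact/measurable_EFinP.
- by apply: emeasurable_funD; apply: measurable_funeM; exact/measurable_EFinP.
move=> x _; rewrite -!EFinM -EFinD lee_fin !mulrA -mulrDl ler_wpM2r //.
have := sqr_ge0 (f x - g x - (g x - h x)); nra.
Qed.

Definition poly_closure f := measurable_fun setT f /\
  forall e : R, 0 < e -> exists p, (sqdist f (horner p) < e%:E)%E.

Lemma poly_closure_trans f : measurable_fun setT f ->
  (forall e : R, 0 < e -> exists2 g, poly_closure g & (sqdist f g < e%:E)%E) ->
  poly_closure f.
Proof.
move=> mf H; split=> // e e0; have e4 : 0 < e / 4 by rewrite divr_gt0.
have [g [mg gp] fg] := H _ e4; have [p pg] := gp _ e4; exists p.
apply: (le_lt_trans (sqdist_le mf mg (measurable_horner p))).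
have -> : e%:E = (2%:E * (e / 4)%:E + 2%:E * (e / 4)%:E)%E.
  by rewrite -!EFinM -EFinD; congr EFin; field.
by apply: lteD; rewrite lte_pmul2l ?lte_fin.
Qed.

Lemma poly_closure_poly p : poly_closure (horner p).
Proof.
split=> [|e e0]; first exact: measurable_horner.
exists p; rewrite /sqdist; under eq_integral do rewrite subrr expr0n mul0r.
by rewrite integral0 lte_fin.
Qed.

Lemma poly_closureD f g : poly_closure f -> poly_closure g ->
  poly_closure (fun x => f x + g x).
Proof.
move=> [mf Hf] [mg Hg]; split=> [|e e0]; first exact: measurable_funD.
have e4 : 0 < e / 4 by rewrite divr_gt0.
have [p fp] := Hf _ e4; have [q gq] := Hg _ e4; exists (p + q).
have mp := measurable_horner (D:=[set: R]) p; have mq := measurable_horner (D:=[set: R]) q.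
apply: (le_lt_trans (sqdist_le (g := fun x => p.[x] + g x) _ _ _)).
- exact: measurable_funD.
- exact: measurable_funD.
- exact: measurable_horner.
have -> : e%:E = (2%:E * (e / 4)%:E + 2%:E * (e / 4)%:E)%E.
  by rewrite -!EFinM -EFinD; congr EFin; field.
apply: lteD; rewrite lte_pmul2l ?lte_fin //.
  rewrite /sqdist; under eq_integral do rewrite opprD addrACA subrr addr0.
  exact: fp.
rewrite /sqdist; under eq_integral do rewrite hornerD opprD addrACA subrr add0r.
exact: gq.
Qed.

Lemma poly_closureZ c f : poly_closure f -> poly_closure (fun x => c * f x).
Proof.
move=> [mf Hf]; split=> [|e e0]; first exact: measurable_funM.
(* Using [c^2 + 1] in place of [c^2] includes the case [c = 0] in the division. *)
have c0 : 0 < c ^+ 2 + 1 by rewrite ltr_wpDl ?sqr_ge0.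
have [p fp] := Hf (e / (c ^+ 2 + 1)) (divr_gt0 e0 c0); exists (c *: p).
have E x : ((c * f x - (c *: p).[x]) ^+ 2 * w x)%:E =
    ((c ^+ 2)%:E * ((f x - p.[x]) ^+ 2 * w x)%:E)%E.
  by rewrite -EFinM; congr EFin; rewrite hornerZ; ring.
have mp := measurable_horner (D:=[set: R]) p; have m := sqdist_measurable mf mp.
rewrite /sqdist; under eq_integral do rewrite E.
rewrite ge0_integralZl_EFin ?sqr_ge0 //; last 2 first.
- by move=> x _; rewrite lee_fin mulr_ge0 // sqr_ge0.
- exact/measurable_EFinP.
have S0 : (0 <= sqdist f (horner p))%E.
  by apply: integral_ge0 => x _; rewrite lee_fin mulr_ge0 // sqr_ge0.
have Sf : sqdist f (horner p) \is a fin_num.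
  by rewrite ge0_fin_numE // (lt_trans fp) // ltry.
move: fp S0; rewrite -/(sqdist _ _) -(fineK Sf) -EFinM !lte_fin lee_fin.
rewrite ltr_pdivlMr // => fp S0; apply: le_lt_trans fp.
by rewrite mulrDr mulr1 mulrC lerDl.
Qed.

Lemma poly_closureB f g : poly_closure f -> poly_closure g ->
  poly_closure (fun x => f x - g x).
Proof.
move=> hf /(poly_closureZ (-1)) hg.
by under eq_fun do rewrite -mulN1r; exact: poly_closureD.
Qed.

Lemma poly_closure_sum n (F : 'I_n -> R -> R) : (forall i, poly_closure (F i)) ->
  poly_closure (fun x => \sum_(i < n) F i x).
Proof.
elim: n F => [|n IH] F HF.
  rewrite (_ : (fun x => _) = horner 0); first exact: poly_closure_poly.
  by apply/funext => x; rewrite big_ord0 horner0.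
under eq_fun do rewrite big_ord_recl.
by apply: poly_closureD => //; exact: (IH (fun i => F (lift ord0 i))).
Qed.

(** Dominated convergence: [g] majorizes the squared errors, so pointwise convergence gives
    convergence in weighted mean square. *)
Lemma poly_closure_cvg (F : nat -> R -> R) f g : (forall n, poly_closure (F n)) ->
  (forall x, F n x @[n --> \oo] --> f x) ->
  (forall n x, (f x - F n x) ^+ 2 <= g x) ->
  leb.-integrable setT (fun x => (g x * w x)%:E) ->
  poly_closure f.
Proof.
move=> HF Ff Fg ig.
have mF n : measurable_fun setT (F n) by have [] := HF n.
have mf : measurable_fun setT f by apply: (measurable_fun_cvg mF) => x _; exact: Ff.
apply: poly_closure_trans => // e e0.
have m n := sqdist_measurable mf (mF n).
have C : sqdist f (F n) @[n --> \oo] --> (\int[leb]_x (cst 0%E x))%E.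
  apply: (@dominated_cvg _ (measurableTypeR R) R leb setT measurableT
    (fun n x => ((f x - F n x) ^+ 2 * w x)%:E) (cst 0%E) (fun x => (g x * w x)%:E)
    (fun n => proj2 (measurable_EFinP _ _) (m n))) => //.
  - move=> x _; apply: cvg_EFin; first by apply: nearW.
    rewrite -[X in _ --> X](mul0r (w x)); apply: cvgM; last exact: cvg_cst.
    have C0 : f x - F n x @[n --> \oo] --> 0.
      by rewrite -[X in _ --> X](subrr (f x)); apply: cvgB => //; exact: cvg_cst.
    by rewrite -[X in _ --> X](mulr0 0); under eq_fun do rewrite expr2; exact: cvgM.
  - move=> n x _; have s0 : 0 <= (f x - F n x) ^+ 2 * w x.
      by apply: mulr_ge0 => //; exact: sqr_ge0.
    by rewrite gee0_abs lee_fin // ler_wpM2r.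
rewrite integral0 in C.
have [N _ HN] : \forall n \near \oo, (sqdist f (F n) < e%:E)%E.
  by apply: (C [set z | (z < e%:E)%E]); apply: open_nbhs_nbhs; split;
    [exact: open_ereal_lt_ereal|rewrite /= lte_fin].
by exists (F N); [exact: HF|apply: HN => /=].
Qed.

Lemma poly_closure_cvg_bounded (F : nat -> R -> R) f c :
  (forall n, poly_closure (F n)) ->
  (forall x, F n x @[n --> \oo] --> f x) ->
  (forall n x, `|f x - F n x| <= c) -> poly_closure f.
Proof.
move=> HF Ff Fc; apply: (poly_closure_cvg (g := fun=> c ^+ 2) HF Ff).
  move=> n x; rewrite -real_normK ?num_real // lerXn2r ?nnegrE //.
  by rewrite (le_trans _ (Fc n x)).
have := w_poly (c ^+ 2)%:P; by under eq_fun do rewrite hornerC.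
Qed.

Lemma indicC (A : set R) x : \1_(~` A) x = 1 - \1_A x :> R.
Proof. by rewrite !indicE in_setC; case: (x \in A); rewrite ?subrr ?subr0. Qed.

Lemma sum_indic_trivIset (F : (set R)^nat) n x : trivIset setT F ->
  \sum_(i < n) \1_(F i) x = \1_(\bigcup_(i < n) F i) x :> R.
Proof.
move=> tF; have [[k /= kn Fk]|nF] := pselect ((\bigcup_(i < n) F i) x).
  rewrite (bigD1 (Ordinal kn)) //= big1 ?addr0.
    by rewrite !indicE !mem_set //; exists k.
  move=> i ik; rewrite indicE memNset // => Fi.
  move/eqP: ik; apply; apply/val_inj => /=.
  by apply: (tF i k) => //; exists x.
rewrite big1 ?indicE ?memNset // => i _.
by rewrite indicE memNset // => Fi; apply: nF; exists i => //=.
Qed.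

(** Dynkin's theorem, starting from the half-open intervals, which are stable under intersection.
    Complements use that [1] is a polynomial, disjoint unions use bounded convergence. *)
Lemma poly_closure_indic (A : set R) :
  (forall s t, poly_closure (\1_(`]s, t]%classic : set R))) ->
  measurable A -> poly_closure (\1_A).
Proof.
move=> Hoc; apply: (@dynkin_induction _ (measurableTypeR R) (@ocitv R)
  (fun A => poly_closure (\1_A))).
- by [].
- exact: ocitvI.
- rewrite (_ : \1_[set: R] = horner 1); first exact: poly_closure_poly.
  by apply/funext => x; rewrite indicT hornerC.
- by move=> _ [[s t] _ <-]; exact: Hoc.
- move=> S _ HS; rewrite (_ : \1_(~` S) = fun x => (1 : {poly R}).[x] - \1_S x).
    by apply: poly_closureB => //; exact: poly_closure_poly.
  by apply/funext => x; rewrite indicC hornerC.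
move=> F mF tF HF.
apply: (@poly_closure_cvg_bounded (fun n x => \sum_(i < n) \1_(F i) x) _ 1).
- by move=> n; apply: poly_closure_sum.
- move=> x; apply: cvg_near_cst.
  have [[k _ Fk]|nF] := pselect ((\bigcup_k F k) x).
    exists k.+1 => // n /= kn; rewrite sum_indic_trivIset // !indicE !mem_set //.
      by exists k.
    by exists k.
  exists 0 => // n _; rewrite sum_indic_trivIset // !indicE !memNset // => -[i _ Fi].
  by apply: nF; exists i.
move=> n x; rewrite sum_indic_trivIset // !indicE ler_norml.
by case: (_ \in _); case: (_ \in _) => /=; apply/andP; split; lra.
Qed.

Import HBNNSimple.

(** Simple functions increase to [f], so the error lies between [0] and [f] and its square is
    dominated by [f^2]. *)
Lemma poly_closure_L2_ge0 f : (forall A : set R, measurable A -> poly_closure (\1_A)) ->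
  measurable_fun setT f -> (forall x, 0 <= f x) ->
  leb.-integrable setT (fun x => (f x ^+ 2 * w x)%:E) -> poly_closure f.
Proof.
move=> HA mf f0 i2; have mEf : measurable_fun setT (EFin \o f) by exact/measurable_EFinP.
pose F := nnsfun_approx measurableT mEf.
have Ff x : F n x @[n --> \oo] --> f x.
  have := @cvg_nnsfun_approx _ _ _ _ measurableT _ mEf (fun x _ => f0 x) x I.
  by move=> /fine_cvg.
have F_le n x : F n x <= f x.
  have nd : nondecreasing_seq (fun n => F n x).
    by move=> k l kl; have := nd_nnsfun_approx measurableT mEf kl => /lefP; exact.
  have cF : cvgn (fun n => F n x) by apply/cvg_ex; exists (f x); exact: Ff.
  by have := nondecreasing_cvgn_le nd cF n; rewrite (cvg_lim _ (Ff x)).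
apply: (poly_closure_cvg (F := fun n x => F n x) (g := fun x => f x ^+ 2)) => //.
  move=> n; rewrite (funext (fimfunEord (F n))).
  by apply: poly_closure_sum => i; apply: poly_closureZ; apply: HA.
move=> n x; rewrite lerXn2r ?nnegrE ?subr_ge0 // gerBl.
exact: fun_ge0.
Qed.

Lemma poly_closure_L2 f : (forall A : set R, measurable A -> poly_closure (\1_A)) ->
  measurable_fun setT f ->
  leb.-integrable setT (fun x => (f x ^+ 2 * w x)%:E) -> poly_closure f.
Proof.
move=> HA mf i2.
have H (g : R -> R) : measurable_fun setT g -> (forall x, 0 <= g x) ->
    (forall x, g x <= `|f x|) -> poly_closure g.
  move=> mg g0 gf; apply: poly_closure_L2_ge0 => //.
  apply: (integrable_dominated _ i2) => [|x].
    by apply: measurable_funM => //; exact: measurable_funX.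
  rewrite ger0_norm ?mulr_ge0 ?sqr_ge0 // ler_wpM2r //.
  by rewrite -[leRHS]real_normK ?num_real // lerXn2r ?nnegrE.
have -> : f = fun x => f^\+ x - f^\- x.
  by apply/funext => x; rewrite -[in LHS](funrposBneg f).
apply: poly_closureB; apply: H.
- exact: measurable_funrpos.
- by move=> x; exact: funrpos_ge0.
- by move=> x; rewrite /funrpos ge_max ler_norm normr_ge0.
- exact: measurable_funrneg.
- by move=> x; exact: funrneg_ge0.
- by move=> x; rewrite /funrneg ge_max -normrN ler_norm normr_ge0.
Qed.
End Closure.

(** * Density *)

Section Density.
Variables (R : realType) (a : nat -> R) (w : R -> R).
Hypothesis a_gt0 : forall n, 0 < a n.
Hypothesis a_div : forall A : R, exists n, A <= \sum_(i < n) (a i)^-1.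
Hypothesis mw : measurable_fun setT w.
Hypothesis w_ge0 : forall x, 0 <= w x.
Hypothesis w_poly : forall p : {poly R},
  (@lebesgue_measure R).-integrable setT (fun x => (p.[x] * w x)%:E).
Local Notation q := (jacobi a).
Hypothesis w_orth : forall i j, has_moment w (q i * q j) (i == j)%:R.
Implicit Types (x y t : R) (z : R[i]).
Local Notation leb := (@lebesgue_measure R).
Local Notation Re := (@complex.Re R).
Local Notation Im := (@complex.Im R).

Lemma has_moment_orth n (c d : 'I_n -> R) :
  has_moment w ((\sum_i c i *: q i) * (\sum_j d j *: q j)) (\sum_i c i * d i).
Proof.
rewrite mulr_suml (eq_bigr (fun i : 'I_n => c i *: (\sum_j d j *: (q i * q j)))).
  apply: has_moment_sum => i.
  rewrite [d i](_ : _ = \sum_j d j * (i == j :> nat)%:R); last first.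
    rewrite (bigD1 i) //= eqxx mulr1 big1 ?addr0 // => j ji.
    by rewrite eq_sym -val_eqE /= in ji *; rewrite (negPf ji) mulr0.
  by apply: has_moment_sum => j; exact: w_orth.
move=> i _; rewrite -scalerAl mulr_sumr; congr (_ *: _).
by apply: eq_bigr => j _; rewrite scalerAr.
Qed.

(** This is [|q_i(z)|^2], a summand of the diagonal Christoffel-Darboux kernel. *)
Definition cd_term z i := Re (jacobiC a i z) ^+ 2 + Im (jacobiC a i z) ^+ 2.

Lemma cd_term_ge0 z i : 0 <= cd_term z i.
Proof. by rewrite addr_ge0 ?sqr_ge0. Qed.

Lemma cd_kernel_ge1 z n : 1 <= \sum_(i < n.+1) cd_term z i.
Proof.
rewrite big_ord_recl {1}/cd_term jacobiC0 /= expr1n expr0n addr0 lerDl.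
by apply: sumr_ge0 => i _; exact: cd_term_ge0.
Qed.

(** Christoffel-Darboux and [cd_kernel_ge1] bound [Im z / a_n] by half of
    [|q_n(z)|^2 + |q_(n+1)(z)|^2]. Consecutive bounds share a term, so the induction keeps only half
    of the last one. *)
Lemma cd_kernel_lower z n : 0 < Im z ->
  Im z * \sum_(i < n) (a i)^-1 <= \sum_(i < n.+1) cd_term z i.
Proof.
move=> z0; suff H : Im z * \sum_(i < n) (a i)^-1 <=
    \sum_(i < n) cd_term z i + cd_term z n / 2.
  apply: (le_trans H); rewrite big_ord_recr /= lerD2l.
  by have := cd_term_ge0 z n; lra.
elim: n => [|n IH].
  by rewrite !big_ord0 mulr0 add0r divr_ge0 // cd_term_ge0.
rewrite [X in Im z * X]big_ord_recr [X in _ <= X + _]big_ord_recr mulrDr /=.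
have C := jacobiC_christoffel a_gt0 n z.
have B : Im z / a n <= (cd_term z n + cd_term z n.+1) / 2.
  rewrite ler_pdivrMr // mulrC.
  apply: (@le_trans _ _ (Im z * \sum_(i < n.+1) cd_term z i)).
    by rewrite ler_peMr ?(ltW z0) // cd_kernel_ge1.
  rewrite -/(cd_term z) -C ler_wpM2l ?(ltW (a_gt0 n)) // /cd_term.
  move: (Re _) (Im (jacobiC a n z)) (Re _) (Im _) => u v u' v'.
  have := sqr_ge0 (u' - v'); have := sqr_ge0 (u + v); nra.
lra.
Qed.

Lemma Im_horner_real (g : {poly R[i]}) x :
  Im g.[x%:C%C] = (\poly_(i < size g) Im g`_i).[x].
Proof.
rewrite horner_poly horner_coef (big_morph Im (@complex_ImD R) (erefl _)).
apply: eq_bigr => i _; rewrite -rmorphXn complex_ImM /= mulr0 add0r mulrC //.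
Qed.

(** With [h = U - i V] and [z = t + i y], the quotient [g = (1 - h) / (X - z)] is a polynomial and
    [1 / (x - z) - g(x) = h(x) / (x - z)]. The imaginary part of [1 / (x - z)] is the Poisson
    kernel, and that of [g] is a real polynomial on the line. *)
Lemma poisson_approx (U V : {poly R}) t y : 0 < y ->
  (map_poly (real_complex R) U -
     'i%C *: map_poly (real_complex R) V).[(t +i* y)%C] = 1 ->
  exists G : {poly R}, forall x, (y / ((x - t) ^+ 2 + y ^+ 2) - G.[x]) ^+ 2 <=
    y ^- 2 * (U * U + V * V).[x].
Proof.
move=> y0; set h := (X in X.[_]) => hz; have d0 x := resolvent_den t x y0.
have /factor_theorem[g Eg] : root (1 - h) (t +i* y)%C.
  by rewrite rootE hornerD hornerN hornerC hz subrr.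
pose G := \poly_(i < size g) Im g`_i; exists G => x.
have Ex : y / ((x - t) ^+ 2 + y ^+ 2) - G.[x] =
    (U.[x] * y - V.[x] * (x - t)) / ((x - t) ^+ 2 + y ^+ 2).
  rewrite /G -Im_horner_real.
  have := congr1 (horner^~ x%:C%C) Eg; rewrite /h !hornerE !horner_map /=.
  case: (g.[x%:C%C]) => g1 g2; simpc => -[E1 E2] /=.
  have dx := lt0r_neq0 (d0 x).
  apply: (mulIf dx); rewrite mulrBl !divfK //.
  have -> : U.[x] = 1 - (g1 * (x - t) + g2 * y) by rewrite -[U.[x]](subKr 1) E1; ring.
  have -> : V.[x] = g2 * (x - t) - g1 * y by rewrite E2; ring.
  by ring.
rewrite Ex expr_div_n ler_pdivrMr ?exprn_gt0 // hornerD !hornerM.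
have y2 : 0 < y ^+ 2 by rewrite exprn_gt0.
rewrite [leRHS](_ : _ = (U.[x] ^+ 2 + V.[x] ^+ 2) * ((x - t) ^+ 2 + y ^+ 2) *
   (((x - t) ^+ 2 + y ^+ 2) / y ^+ 2)); last by field; rewrite lt0r_neq0.
apply: (@le_trans _ _ ((U.[x] ^+ 2 + V.[x] ^+ 2) * ((x - t) ^+ 2 + y ^+ 2))).
  (* Cauchy-Schwarz, through Lagrange's identity with this discarded square. *)
  have := sqr_ge0 (U.[x] * (x - t) + V.[x] * y); nra.
rewrite ler_peMr ?mulr_ge0 ?addr_ge0 ?sqr_ge0 //.
by rewrite ler_pdivlMr // mul1r lerDr sqr_ge0.
Qed.

Lemma poisson_closure t y : 0 < y ->
  poly_closure w (fun x => y / ((x - t) ^+ 2 + y ^+ 2)).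
Proof.
move=> y0; have d0 x := resolvent_den t x y0.
have mP : measurable_fun setT (fun x => y / ((x - t) ^+ 2 + y ^+ 2)).
  apply: continuous_measurable_fun => x; apply: cvgM; first exact: cvg_cst.
  apply: cvgV; first by rewrite lt0r_neq0.
  have E : (fun s => (s - t) ^+ 2 + y ^+ 2) = horner (('X - t%:P) ^+ 2 + (y ^+ 2)%:P).
    by apply/funext => s; rewrite !hornerE.
  have := @continuous_horner _ (('X - t%:P) ^+ 2 + (y ^+ 2)%:P) x.
  by rewrite -E; exact.
split=> // e e0.
pose z : R[i] := (t +i* y)%C.
(* Multiplied by [y], this lower bound exceeds [1 / (e y^2)], strictly thanks to the [1]; the final
   error [1 / (K y^2)] is then below [e]. *)
have [N HN] := a_div (1 + (e * y ^+ 3)^-1).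
pose K := \sum_(i < N.+1) cd_term z i.
have K1 : 1 <= K := cd_kernel_ge1 z N.
have K0 : 0 < K by rewrite (lt_le_trans ltr01).
have Ke : (e * y ^+ 2)^-1 < K.
  apply: (lt_le_trans _ (@cd_kernel_lower z N y0)).
  apply: (@lt_le_trans _ _ (y * (1 + (e * y ^+ 3)^-1))); last by rewrite ler_wpM2l // ltW.
  rewrite mulrDr mulr1 [X in _ < _ + X](_ : _ = (e * y ^+ 2)^-1) ?ltrDr //.
  by field; rewrite !lt0r_neq0.
(* [U - i V] is the reproducing kernel normalized to the value [1] at [z]; its squared norm is
   [1 / K]. *)
pose u (i : 'I_N.+1) := Re (jacobiC a i z) / K.
pose v (i : 'I_N.+1) := Im (jacobiC a i z) / K.
pose U := \sum_i u i *: q i; pose V := \sum_i v i *: q i.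
pose h := map_poly (real_complex R) U - 'i%C *: map_poly (real_complex R) V.
have hz : h.[z] = 1.
  rewrite /h hornerD hornerN hornerZ /U /V !rmorph_sum !horner_sum mulr_sumr -sumrB.
  rewrite (eq_bigr (fun i : 'I_N.+1 => (cd_term z i / K)%:C%C)).
    by rewrite -rmorph_sum -mulr_suml divff ?lt0r_neq0 // rmorph1.
  move=> i _; rewrite /= !map_polyZ /= !hornerZ -/(jacobiC a i z) /u /v /cd_term.
  case: (jacobiC a i z) => r s /=; simpc.
  by congr (_ +i* _)%C; ring.
have [G PG] := poisson_approx y0 hz; exists G.
have [iU eU] := has_momentZ (y ^- 2) (has_momentD (has_moment_orth u u) (has_moment_orth v v)).
apply: (@le_lt_trans _ _ (\int[leb]_x ((y ^- 2 *: (U * U + V * V)).[x] * w x)%:E)%E).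
  apply: ge0_le_integral => //.
  - move=> x _; rewrite lee_fin; apply: mulr_ge0 => //; exact: sqr_ge0.
  - apply/measurable_EFinP; apply: sqdist_measurable => //; exact: measurable_horner.
  - by apply/measurable_EFinP; apply: measurable_funM => //; exact: measurable_horner.
  - by move=> x _; rewrite lee_fin ler_wpM2r // hornerZ.
rewrite eU lte_fin -big_split /= (eq_bigr (fun i : 'I_N.+1 => cd_term z i * K ^- 2)); last first.
  by move=> i _; rewrite /u /v /cd_term; field; rewrite lt0r_neq0.
rewrite -mulr_suml -/K.
move: Ke; rewrite -ltf_pV2 ?posrE ?invr_gt0 ?mulr_gt0 ?exprn_gt0 // invrK.
rewrite [X in _ -> X < _](_ : _ = K^-1 / y ^+ 2); last by field; rewrite !lt0r_neq0.
by rewrite ltr_pdivrMr ?exprn_gt0.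
Qed.
Lemma is_derive_atan_shift x y (r : R) : 0 < y ->
  is_derive r 1 (fun r : R => atan ((r - x) / y) : R) (y / ((x - r) ^+ 2 + y ^+ 2)).
Proof.
move=> y0; have := lt0r_neq0 (resolvent_den r x y0); have := lt0r_neq0 y0.
move=> yn dn; apply: is_derive_eq; rewrite /GRing.scale /=; field.
by rewrite dn yn.
Qed.

(** With denominators [A] and [B], the difference quotient is at most [(A + B) / (2 A B)], and both
    [A] and [B] are at least [y^2]. *)
Lemma poisson_lipschitz x y r s : 0 < y ->
  `|y / ((x - r) ^+ 2 + y ^+ 2) - y / ((x - s) ^+ 2 + y ^+ 2)| <= `|r - s| / y ^+ 2.
Proof.
move=> y0; have dr := resolvent_den r x y0; have ds := resolvent_den s x y0.
have y2 : 0 < y ^+ 2 by rewrite exprn_gt0.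
rewrite [X in `|X|](_ : _ = (r - s) * (y * ((x - r) + (x - s)) /
  (((x - r) ^+ 2 + y ^+ 2) * ((x - s) ^+ 2 + y ^+ 2)))); last first.
  by field; rewrite !lt0r_neq0.
rewrite normrM ler_wpM2l //.
set A := (x - r) ^+ 2 + y ^+ 2 in dr *; set B := (x - s) ^+ 2 + y ^+ 2 in ds *.
have Ay : y ^+ 2 <= A by rewrite /A lerDr sqr_ge0.
have By : y ^+ 2 <= B by rewrite /B lerDr sqr_ge0.
rewrite normrM normfV (gtr0_norm (mulr_gt0 dr ds)) ler_pdivrMr ?mulr_gt0 //.
have h : `|y * (x - r + (x - s))| <= (A + B) / 2.
  rewrite ler_norml /A /B; have := sqr_ge0 (x - r + y); have := sqr_ge0 (x - r - y).
  have := sqr_ge0 (x - s + y); have := sqr_ge0 (x - s - y).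
  by move=> *; apply/andP; split; nra.
apply: (le_trans h); rewrite ler_pdivlMl //.
have h1 : 0 <= A * (B - y ^+ 2) by rewrite mulr_ge0 ?(ltW dr) // subr_ge0.
have h2 : 0 <= B * (A - y ^+ 2) by rewrite mulr_ge0 ?(ltW ds) // subr_ge0.
nra.
Qed.

Lemma atan_cell x y r d : 0 < y -> 0 < d ->
  `|atan ((r + d - x) / y) - atan ((r - x) / y) - d * (y / ((x - r) ^+ 2 + y ^+ 2))|
  <= d ^+ 2 / y ^+ 2.
Proof.
move=> y0 d0; have rd : r < r + d by rewrite ltrDl.
have [|s sin ->] := MVT rd (fun s _ => is_derive_atan_shift x s y0).
  apply: continuous_subspaceT => s.
  apply: differentiable_continuous; apply/derivable1_diffP.
  by have ? := is_derive_atan_shift x s y0; exact: ex_derive.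
rewrite addrAC subrr add0r mulrC -mulrBr normrM (gtr0_norm d0) expr2 -mulrA.
rewrite ler_wpM2l ?(ltW d0) //; apply: (le_trans (poisson_lipschitz _ _ _ y0)).
rewrite ler_wpM2r ?invr_ge0 ?sqr_ge0 //.
by move: sin; rewrite in_itv /= => /andP[s1 s2]; rewrite ger0_norm; lra.
Qed.

(** The function is the integral of the Poisson kernels as their centre runs over [[s, t]]. Its
    Riemann sums lie in the closure, and by [atan_cell] they converge uniformly at rate [1 / n]. *)
Lemma atan_closure y s t : 0 < y -> s < t ->
  poly_closure w (fun x => atan ((t - x) / y) - atan ((s - x) / y)).
Proof.
move=> y0 st; pose d n := (t - s) / n.+1%:R.
have d0 n : 0 < d n by rewrite divr_gt0 // subr_gt0.
have E n x : `|(atan ((t - x) / y) - atan ((s - x) / y)) -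
    \sum_(i < n.+1) d n * (y / ((x - (s + i%:R * d n)) ^+ 2 + y ^+ 2))| <=
    (t - s) ^+ 2 / y ^+ 2 * n.+1%:R^-1.
  have -> : atan ((t - x) / y) - atan ((s - x) / y) = \sum_(i < n.+1)
      (atan ((s + i%:R * d n + d n - x) / y) - atan ((s + i%:R * d n - x) / y)).
    rewrite -(big_mkord xpredT (fun i => atan ((s + i%:R * d n + d n - x) / y) -
      atan ((s + i%:R * d n - x) / y))).
    rewrite (eq_bigr (fun i => atan ((s + i.+1%:R * d n - x) / y) -
       atan ((s + i%:R * d n - x) / y))).
      rewrite (telescope_sumr (fun i => atan ((s + i%:R * d n - x) / y))) //.
      have -> : n.+1%:R * d n = t - s by rewrite /d mulrC divfK // pnatr_eq0.
      by rewrite mul0r addr0 (addrC s (t - s)) subrK.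
    move=> i _; have -> : i.+1%:R * d n = i%:R * d n + d n.
      by rewrite -[i.+1%:R]natr1 mulrDl mul1r.
    by rewrite addrA.
  rewrite -sumrB; apply: (le_trans (ler_norm_sum _ _ _)).
  apply: (@le_trans _ _ (\sum_(i < n.+1) d n ^+ 2 / y ^+ 2)).
    by apply: ler_sum => i _; exact: atan_cell.
  rewrite sumr_const card_ord -mulr_natl le_eqVlt; apply/orP; left; apply/eqP.
  by rewrite /d; field; rewrite !lt0r_neq0.
apply: (@poly_closure_cvg_bounded _ _ mw w_ge0 w_poly (fun n x =>
  \sum_(i < n.+1) d n * (y / ((x - (s + i%:R * d n)) ^+ 2 + y ^+ 2))) _
  ((t - s) ^+ 2 / y ^+ 2)).
- move=> n; apply: (poly_closure_sum mw w_ge0) => i.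
  by apply: (poly_closureZ mw w_ge0); exact: poisson_closure.
- move=> x; apply/cvgrPdist_le => e e0.
  have C : (t - s) ^+ 2 / y ^+ 2 * n.+1%:R^-1 @[n --> \oo] --> 0.
    rewrite -[X in _ --> X](mulr0 ((t - s) ^+ 2 / y ^+ 2)).
    by apply: cvgM; [exact: cvg_cst|exact: cvg_harmonic].
  near=> n; apply: (le_trans (E n x)); near: n; exact: (cvgr_le _ C).
move=> n x; apply: (le_trans (E n x)); rewrite ler_piMr ?divr_ge0 ?sqr_ge0 //.
by rewrite invf_le1 // ler1n.
Unshelve. all: by end_near. Qed.

(* The shift [1 / (m + 1)] is large against the width [1 / (m + 1) ^ 2], so the
   limit at [x = t] is [pi / 2] and half-open intervals come out exactly. *)
Lemma cvg_atan_step t x :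
  atan ((t + m.+1%:R^-1 - x) / m.+1%:R ^- 2) @[m --> \oo] -->
  (if x <= t then pi / 2 else - (pi / 2)).
Proof.
have E m : (t + m.+1%:R^-1 - x) / m.+1%:R ^- 2 = (t - x) * m.+1%:R ^+ 2 + m.+1%:R.
  have : m.+1%:R != 0 :> R by rewrite pnatr_eq0.
  by move: (m.+1%:R : R) => M Mn; field.
under eq_fun do rewrite E.
have S A : \forall m \near \oo, A <= m.+1%:R :> R.
  near=> m; apply: (@le_trans _ _ m%:R); last by rewrite ler_nat.
  near: m; exact: nbhs_infty_ger.
case: leP => xt.
  apply: (cvg_comp _ _ _ (@cvgy_atan R)); apply/cvgryPge => A; near=> m.
  rewrite ler_wpDl ?mulr_ge0 ?sqr_ge0 ?subr_ge0 //; near: m; exact: S.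
under eq_fun do rewrite -[X in atan X]opprK atanN.
apply: cvgN; apply: (cvg_comp _ _ _ (@cvgy_atan R)); apply/cvgryPge => A; near=> m.
have h1 : (1 + `|A|) / (x - t) <= m.+1%:R by near: m; exact: S.
have h2 : 1 <= m.+1%:R :> R by rewrite ler1n.
move: h1; rewrite ler_pdivrMr ?subr_gt0 // => h1.
have := ler_norm A; have := normr_ge0 A.
move: (m.+1%:R) `|A| h1 h2 => M B h1 h2 B0 AB.
have h3 : 0 <= (M * (x - t) - (1 + B)) * M by rewrite mulr_ge0 ?subr_ge0 //; lra.
have h4 : 0 <= B * (M - 1) by rewrite mulr_ge0 // subr_ge0.
nra.
Unshelve. all: by end_near. Qed.

Lemma step_closure s t : poly_closure w (\1_(`]s, t]%classic : set R)).
Proof.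
have [ts|st] := leP t s.
  rewrite set_itv_ge ?bnd_simp -?leNgt // indic0.
  rewrite (_ : cst 0 = horner 0); first exact: poly_closure_poly.
  by apply/funext => x; rewrite horner0.
pose e m : R := m.+1%:R^-1; pose y m : R := m.+1%:R ^- 2.
have pi0 := pi_gt0 R.
(* The bound [2] allows [1] for the indicator and [1] for the arctangent difference divided by
   [pi]. *)
apply: (@poly_closure_cvg_bounded _ _ mw w_ge0 w_poly (fun m x =>
  pi^-1 * (atan ((t + e m - x) / y m) - atan ((s + e m - x) / y m))) _ 2).
- move=> m; apply: (poly_closureZ mw w_ge0); apply: atan_closure.
    by rewrite /y invr_gt0 exprn_gt0.
  by rewrite ltrD2r.
- move=> x; have C : atan ((t + e m - x) / y m) - atan ((s + e m - x) / y m) @[m --> \oo] -->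
      (if x <= t then pi / 2 else - (pi / 2)) -
      (if x <= s then pi / 2 else - (pi / 2)).
    by apply: cvgB; exact: cvg_atan_step.
  rewrite [X in _ --> X](_ : _ = pi^-1 * ((if x <= t then pi / 2 else - (pi / 2)) -
    (if x <= s then pi / 2 else - (pi / 2)))); first by apply: cvgM; [exact: cvg_cst|exact: C].
  rewrite indicE mem_setE in_itv /=; case: (leP x s) => xs /=.
    by rewrite (le_trans xs (ltW st)) subrr mulr0.
  case: (leP x t) => xt; last by rewrite subrr mulr0.
  by rewrite opprK -splitr mulVf // lt0r_neq0.
move=> m x; apply: (le_trans (ler_normB _ _)).
rewrite -[2 in leRHS]/(1 + 1); apply: lerD.
  by rewrite indicE ger0_norm ?ler0n // lern1 leq_b1.
rewrite normrM normfV (gtr0_norm pi0) mulrC ler_pdivrMr // mul1r ler_norml.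
have := atan_gtNpi2 ((t + e m - x) / y m); have := atan_ltpi2 ((t + e m - x) / y m).
have := atan_gtNpi2 ((s + e m - x) / y m); have := atan_ltpi2 ((s + e m - x) / y m).
by move=> *; apply/andP; split; lra.
Qed.

Lemma jacobi_dense (f : R -> R) : measurable_fun setT f ->
  leb.-integrable setT (fun x => (f x ^+ 2 * w x)%:E) -> poly_closure w f.
Proof.
apply: (poly_closure_L2 mw w_ge0) => A mA.
exact: (poly_closure_indic mw w_ge0 w_poly step_closure).
Qed.
End Density.

(** * The weight *)

Section Uniqueness.
Variables (R : realType) (w : R -> R).
Implicit Types (p q : nat -> {poly R}).

Lemma has_moment_coord p n (c : nat -> R) j :
  (forall i j, has_moment w (p i * p j) (i == j)%:R) ->
  has_moment w ((\sum_(i < n) c i *: p i) * p j) (if (j < n)%N then c j else 0).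
Proof.
move=> op; rewrite mulr_suml (eq_bigr (fun i : 'I_n => c i *: (p i * p j))); last first.
  by move=> i _; rewrite scalerAl.
rewrite (_ : (if _ then _ else _) = \sum_(i < n) c i * (i == j :> nat)%:R).
  by apply: has_moment_sum => i; exact: op.
case: ltnP => jn.
  rewrite (bigD1 (Ordinal jn)) //= eqxx mulr1 big1 ?addr0 // => i ij.
  by rewrite -val_eqE /= in ij; rewrite (negPf ij) mulr0.
by rewrite big1 // => i _; rewrite ltn_eqF ?mulr0 // (leq_trans (ltn_ord i)).
Qed.

(** Matching leading coefficients, [p_n - c q_n] has degree below [n] and is orthogonal to every
    lower [q_j], hence zero; normalization gives [c^2 = 1], and [c > 0]. This transfers results on
    the Jacobi polynomials to any orthonormal sequence. *)
Lemma orthonormal_unique p q :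
  (forall n, size (p n) = n.+1) -> (forall n, size (q n) = n.+1) ->
  (forall n, 0 < lead_coef (p n)) -> (forall n, 0 < lead_coef (q n)) ->
  (forall i j, has_moment w (p i * p j) (i == j)%:R) ->
  (forall i j, has_moment w (q i * q j) (i == j)%:R) -> p = q.
Proof.
move=> sp sq lp lq op oq; apply/funext => n.
have lower (r : nat -> {poly R}) (h : {poly R}) : (forall n, size (r n) = n.+1) ->
    (forall i j, has_moment w (r i * r j) (i == j)%:R) -> (size h <= n)%N ->
    has_moment w (h * r n) 0.
  move=> sr or hn; have [c ->] := poly_in_graded_span sr hn.
  by have := @has_moment_coord r n c n or; rewrite ltnn.
pose c := lead_coef (p n) / lead_coef (q n).
have qn0 := lt0r_neq0 (lq n).
have c0 : 0 < c by rewrite divr_gt0.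
have sh : (size (p n - c *: q n)%R <= n)%N.
  apply/leq_sizeP => j nj; rewrite coefB coefZ.
  move: nj; rewrite leq_eqVlt => /orP[/eqP <-|nj].
    have -> : (p n)`_n = lead_coef (p n) by rewrite lead_coefE sp.
    have -> : (q n)`_n = lead_coef (q n) by rewrite lead_coefE sq.
    by rewrite divfK // subrr.
  by rewrite !nth_default ?mulr0 ?subr0 ?sp ?sq.
have [d Ed] := poly_in_graded_span sq sh.
have d0 (j : 'I_n) : d j = 0.
  have := @has_moment_coord q n d j oq; rewrite ltn_ord -Ed => H.
  apply: (has_moment_inj H).
  rewrite mulrBl -scaleN1r -scalerAl.
  have qj : (size (q j) <= n)%N by rewrite sq ltn_ord.
  have := has_momentD (lower p (q j) sp op qj)
    (has_momentZ (-1) (has_momentZ c (lower q (q j) sq oq qj))).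
  by rewrite !mulr0 addr0 ![q j * _]mulrC.
have pq : p n = c *: q n.
  apply/eqP; rewrite -subr_eq0 Ed big1 // => i _.
  by rewrite d0 scale0r.
have c1 : c ^+ 2 = 1.
  have := has_momentZ c (has_momentZ c (oq n n)); rewrite eqxx mulr1 => H.
  have := op n n; rewrite eqxx pq -scalerAl -scalerAr => H'.
  by rewrite expr2; exact: (has_moment_inj H H').
by rewrite pq (_ : c = 1) ?scale1r //; apply/eqP; rewrite -(@eqrXn2 _ 2) ?expr1n ?c1 // ltW.
Qed.
End Uniqueness.

(** * Orthonormality with respect to the limit weight *)

Section Weight.
Variables (R : realType) (b : nat -> R).
Hypothesis b_gt0 : forall n, 0 < b n.
Hypothesis b_nd : forall n, b n <= b n.+1.
Hypothesis b_cvg : b @ \oo --> +oo.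
Local Notation leb := (@lebesgue_measure R).
Local Notation q := (jacobi (paired b)).

Definition limit_weight (x : R) : R := (pi * limn (fun k => (form_poly b k).[x]))^-1.
Local Notation w := limit_weight.

Let wk k := bs_weight (paired b) k.*2.

Lemma limit_weight_gt0 x : 0 < w x.
Proof.
have [S S0 /cvg_lim CS] := form_poly_cvg b_gt0 b_nd b_cvg x.
by rewrite /w CS // invr_gt0 mulr_gt0 ?pi_gt0.
Qed.

Let wk_cvg x : wk k x @[k --> \oo] --> w x.
Proof.
have [S S0 CS] := form_poly_cvg b_gt0 b_nd b_cvg x.
rewrite /w (cvg_lim _ CS) //; under eq_fun do rewrite /wk bs_weight_form.
apply: cvgV; first by rewrite lt0r_neq0 // mulr_gt0 ?pi_gt0.
by apply: cvgM => //; exact: cvg_cst.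
Qed.

Let mwk k : measurable_fun setT (wk k).
Proof.
apply: continuous_measurable_fun; apply: continuous_bs_weight => n.
exact: paired_gt0.
Qed.

Let wk_ge0 k x : 0 <= wk k x.
Proof. by apply: ltW; apply: bs_weight_gt0 => n; exact: paired_gt0. Qed.

Let wk_moment h : exists v K, forall k, (K <= k)%N -> has_moment (wk k) h v.
Proof.
have [v H] := bs_weight_moment (paired_gt0 b_gt0) h; exists v, (size h) => k hk.
by apply: H; rewrite (leq_trans hk) // -addnn leq_addr.
Qed.

Lemma measurable_limit_weight : measurable_fun setT w.
Proof. exact: (limit_weight_measurable mwk wk_cvg). Qed.

Lemma limit_weight_poly (p : {poly R}) :
  leb.-integrable setT (fun x => (p.[x] * w x)%:E).
Proof. exact: (limit_weight_integrable mwk wk_ge0 wk_cvg wk_moment). Qed.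

Lemma limit_weight_orth i j : has_moment w (q i * q j) (i == j)%:R.
Proof.
apply: (moment_limit mwk wk_ge0 wk_cvg
  (bs_weight_locally_bounded b_gt0 b_nd b_cvg) wk_moment (K := maxn i j)) => k.
rewrite geq_max => /andP[ik jk].
have kk : (k <= k.*2)%N by rewrite -addnn leq_addr.
by apply: bs_weight_orthonormal; [exact: paired_gt0|exact: leq_trans kk|exact: leq_trans kk].
Qed.
End Weight.

(** * Growth of [b], and assembly of the weight, the basis and the pointwise bound *)

Lemma ratio_bound (R : realType) (b : nat -> R) : (forall n, 0 < b n) ->
  (fun n => b n.+1 / b n) @ \oo --> (1 : R) ->
  exists rho, forall n, b n.+1 <= rho * b n.
Proof.
move=> b0 rc; have [N _ HN] : \forall n \near \oo, b n.+1 / b n <= 2.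
  by apply: (cvgr_le _ rc); rewrite ltr1n.
(* The [2] bounds the ratios from [N] on, the sum the finitely many earlier ones. *)
exists (2 + \sum_(i < N) b i.+1 / b i) => n; rewrite -ler_pdivrMr //.
have s0 i : 0 <= b i.+1 / b i by rewrite divr_ge0 // ltW.
have [nN|Nn] := ltnP n N.
  rewrite (bigD1 (Ordinal nN)) //= addrCA lerDl addr_ge0 //.
  exact: sumr_ge0.
by apply: (le_trans (HN n Nn)); rewrite lerDl sumr_ge0.
Qed.

Lemma paired_divergent (R : realType) (b : nat -> R) (rho : R) :
  (forall n, 0 < b n) -> (forall n, b n <= b n.+1) ->
  (forall n, b n.+1 <= rho * b n) ->
  series (fun n => (b n)^-1) @ \oo --> +oo ->
  forall A : R, exists n, A <= \sum_(i < n) (paired b i)^-1.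
Proof.
move=> b0 bn br sb A.
have rho1 : 1 <= rho.
  by rewrite -(ler_pM2r (b0 0)) mul1r (le_trans (bn 0)).
have rho0 : 0 < rho by apply: lt_le_trans rho1.
have pb i : paired b i <= rho * b i.
  rewrite /paired; case: ifP => oi; last by rewrite ler_peMl // ltW.
  have i0 : (i.-1.+1 = i)%N by case: i oi.
  rewrite -[leRHS]ger0_norm ?mulr_ge0 ?(ltW rho0) ?(ltW (b0 _)) // -sqrtr_sqr.
  rewrite ler_sqrt ?sqr_ge0 // expr2; apply: ler_pM => //; try exact: ltW.
  by rewrite (le_trans (bn _)) // i0 ler_peMl // ltW.
have /cvgryPge/(_ (rho * A))[n _ H] := sb; exists n.
have := H n (leqnn n); rewrite /series /= big_mkord => {}H.
rewrite -(ler_pM2l rho0); apply: (le_trans H); rewrite mulr_sumr ler_sum // => i _.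
have p0 := paired_gt0 b0 i.
by rewrite ler_pdivlMr // mulrC ler_pdivrMr.
Qed.

Theorem theorem1p3 (R : realType) (b : nat -> R) :
  monotone_seq b ->
  (forall n, 0 < b n) ->
  b @ \oo --> +oo ->
  (fun n => b n.+1 / b n) @ \oo --> (1 : R) ->
  series (fun n => (b n)^-1) @ \oo --> +oo ->
  exists w : R -> R,
    is_weight w /\
    (exists p : nat -> {poly R}, orthonormal_polys w p) /\
    forall p : nat -> {poly R}, orthonormal_polys w p ->
      is_L2_basis w p /\
      exists C : R -> R,
        (forall x, 0 < C x) /\ locally_bounded C /\
        forall (n : nat) (x : R), (p n).[x] ^+ 2 <= C x / b n.
Proof.
move=> mono b0 bc rc sc.
(* A nonincreasing [b] would stay below [b 0], contrary to its divergence. *)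
have bn n : b n <= b n.+1.
  case: mono => [//|dec]; exfalso.
  have le0 k : b k <= b 0 by elim: k => // k; exact: le_trans.
  have /cvgryPge/(_ (b 0 + 1))[N _ H] := bc.
  by have := le_trans (H N (leqnn N)) (le0 N); rewrite gerDl ler10.
have [rho br] := ratio_bound b0 rc.
have pd := paired_divergent b0 bn br sc.
pose q := jacobi (paired b); have p0 := paired_gt0 b0.
pose w := limit_weight b.
have w0 x : 0 < w x := limit_weight_gt0 b0 bn bc x.
have mw : measurable_fun setT w := measurable_limit_weight b0 bn bc.
have wp := limit_weight_poly b0 bn bc.
have wo i j : has_moment w (q i * q j) (i == j)%:R := limit_weight_orth b0 bn bc i j.
exists w; split.
  split=> //; split=> // n; have := wp 'X^n.
  by under eq_fun do rewrite hornerXn.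
have wipE p r : wip w (fun x => p.[x]) (fun x => r.[x]) =
    (\int[@lebesgue_measure R]_x ((p * r).[x] * w x)%:E)%E.
  by apply: eq_integral => x _; rewrite hornerM.
split.
  exists q; split; first exact: size_jacobi.
  split; first exact: lead_jacobi_gt0.
  by move=> n m; rewrite wipE; have [] := wo n m.
move=> p [sp [lp op]].
have {op} op i j : has_moment w (p i * p j) (i == j)%:R.
  by split; [exact: wp|rewrite -wipE].
have -> : p = q.
  apply: (orthonormal_unique sp (size_jacobi p0) lp (lead_jacobi_gt0 p0) op wo).
split.
  move=> f [mf if2] e e0.
  have [_ /(_ e e0)[g fg]] := jacobi_dense p0 pd mw (fun x => ltW (w0 x)) wp wo mf if2.
  have [c Ec] := poly_in_graded_span (size_jacobi p0) (leqnn (size g)).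
  exists (size g), c; apply: le_lt_trans fg; rewrite le_eqVlt; apply/orP; left.
  apply/eqP; apply: eq_integral => x _.
  have /(congr1 (horner^~ x)) /= -> := Ec; rewrite horner_sum.
  by under [in RHS]eq_bigr do rewrite hornerZ.
have bd M : exists B, forall n x, `|x| <= M -> b n * (q n).[x] ^+ 2 <= B.
  exact: jacobi_locally_bounded.
(* The function [C] is the supremum of [E x] plus [1], which makes it strictly positive; the uniform
   bounds on compact sets make it locally bounded. *)
pose E x := [set b n * (q n).[x] ^+ 2 | n in [set: nat]].
have t0 n x : 0 <= b n * (q n).[x] ^+ 2 by rewrite mulr_ge0 ?sqr_ge0 // ltW.
have E0 x : E x !=set0 by exists (b 0 * (q 0).[x] ^+ 2), 0.
have sE x : has_sup (E x).
  split=> //; have [B HB] := bd `|x|; exists B => _ [n _ <-]; exact: HB.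
have Eub n x : b n * (q n).[x] ^+ 2 <= sup (E x).
  by apply: ub_le_sup; [have [] := sE x|exists n].
exists (fun x => sup (E x) + 1); split=> [x|].
  by rewrite ltr_wpDl // (le_trans (t0 0 x)).
split=> [x|n x]; last first.
  by rewrite ler_pdivlMr // mulrC (le_trans (Eub n x)) // lerDl ler01.
exists 1 => //; have [B HB] := bd (`|x| + 1); exists (B + 1) => y yx.
rewrite ger0_norm ?addr_ge0 // ?(le_trans (t0 0 y)) // lerD2r.
apply: ge_sup => // _ [n _ <-]; apply: HB.
rewrite -lerBlDl; apply: le_trans (ltW yx); exact: lerB_dist.
Qed.
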